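(* Let $N\in\mathbb{N}$ and for $i=1,\dots,N$ let $X_i\subset\mathbb{R}^{d_i}$ be compact, $X=\prod_iX_i$, and let $\mu_i$ be Borel probability measures supported on $X_i$. Let $(\varphi,\psi)$ be convex conjugates with $\varphi$ dual regular. Assume $\mu_1,\dots,\mu_N$ satisfy $I(d_\mu,s)$ for some $s\in\mathbb{N}$ and $d_\mu\in(2s,\infty)$, and that $c\in C^s(X)$ and $\psi\in C^{s,1}(\mathbb{R})$. For each $i$, let $\hat\mu_i^n$ be the empirical measure of $n$ i.i.d. samples from $\mu_i$, with samples independent across $i$. Then there is a constant $C$ independent of $n$ such that \[ \mathbb{E}\left[\left|\mathsf{OT}_\varphi(\mu_1,\dots,\mu_N)-\mathsf{OT}_\varphi(\hat\mu^n_1,\dots,\hat\mu^n_N)\right|\right]\le C\,n^{-s/d_\mu}. \]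
   Context: $(\varphi,\psi)$ convex conjugates: $\varphi:\mathbb{R}_+\to\mathbb{R}$ strictly convex, bounded below, $\varphi(1)=0$, $\varphi(x)/x\to\infty$, $\psi(y)=\sup_{x\ge0}(xy-\varphi(x))$. Dual regular: $\psi\in C^1$, $\psi'(x)\ge x$ for all $x\ge C$ for some $C>0$, and there are $x_0,\delta\in\mathbb{R}_+$ with $\psi'(x_0)=1$ and $\psi$ strictly convex on $[x_0-\delta,\infty)$. $\mathsf{OT}_\varphi(\nu_1,\dots,\nu_N)=\inf_{\pi}\int c\,d\pi+D_\varphi(\pi,\nu_1\otimes\cdots\otimes\nu_N)$, infimum over couplings $\pi$ with marginals $\nu_i$, where $D_\varphi(Q,P)=\int\varphi(dQ/dP)\,dP$ if $Q\ll P$, $+\infty$ otherwise. $C^{s,1}(\mathbb{R})$: $s$-times continuously differentiable functions with Lipschitz $s$-th derivative. A measure $\mu$ on $\mathbb{R}^{d'}$ satisfies $I(d_\mu,s)$ if there exists $K>0$ such that for every $\varepsilon>0$ there exist $\Omega_\varepsilon\subset\mathbb{R}^{d'}$ with $\mu(\Omega_\varepsilon^c)\le\mathbb{1}_{\{d_\mu>2s\}}\varepsilon^{sd_\mu/(d_\mu-2s)}$ and a finite measurable partition $\mathcal{A}_\varepsilon$ of $\Omega_\varepsilon$ whose sets all have diameter at most $\varepsilon$ and with at most $K\varepsilon^{-d_\mu}$ sets. *)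

(* Defs.v *)
From HB Require Import structures.
From mathcomp Require Import all_boot all_order all_algebra.
From mathcomp Require Import all_classical all_reals all_analysis.
Set Implicit Arguments. Unset Strict Implicit. Unset Printing Implicit Defensive.
Import Order.TTheory GRing.Theory Num.Theory.
Import numFieldNormedType.Exports.
Local Open Scope classical_set_scope.
Local Open Scope ring_scope.

Section Defs.
Variable R : realType.

Definition Rvec (n : nat) := g_sigma_algebraType (@open 'rV[R]_n).

Definition edist (n : nat) (x y : 'rV[R]_n) : R :=
  Num.sqrt (\sum_(j < n) (x 0 j - y 0 j) ^+ 2).

Definition cond_I (n : nat) (mu : set (Rvec n) -> \bar R) (dmu : R) (s : nat)
  : Prop :=
  exists K : R, 0 < K /\
    forall eps : R, 0 < eps ->
      exists (Om : set (Rvec n)) (m : nat) (A : 'I_m -> set (Rvec n)),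
        [/\ (mu (~` Om) <=
              (if 2 * s%:R < dmu
               then eps `^ (s%:R * dmu / (dmu - 2 * s%:R)) else 0)%:E)%E,
            [/\ (forall k, measurable (A k)),
                 (forall k l, k != l -> A k `&` A l = set0)
               & (\bigcup_k A k) = Om],
            (forall k x y, A k x -> A k y -> edist x y <= eps)
          & m%:R <= K * eps `^ (- dmu)].

Section Product.
Variables (N : nat) (d : 'I_N -> nat).

(** The product space R^{d_1} x ... x R^{d_N} = R^{d_1 + ... + d_N}. *)
Definition Dtot := (\sum_(i < N) d i)%N.

Definition blk (x : 'rV[R]_Dtot) (i : 'I_N) : 'rV[R]_(d i) :=
  @submxrow R N d 1 x i.

Definition Xprod (X : forall i, set 'rV[R]_(d i)) : set (Rvec Dtot) :=
  [set x | forall i, X i (blk x i)].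

(** P is the product measure nu_1 (x) ... (x) nu_N (determined by its
    values on measurable rectangles). *)
Definition is_prod_meas (P : set (Rvec Dtot) -> \bar R)
  (nu : forall i, set (Rvec (d i)) -> \bar R) : Prop :=
  forall A : forall i, set (Rvec (d i)), (forall i, measurable (A i)) ->
    P [set x | forall i, A i (blk x i)] = \big[*%E/1%E]_(i < N) nu i (A i).

Definition is_coupling (pi : set (Rvec Dtot) -> \bar R)
  (nu : forall i, set (Rvec (d i)) -> \bar R) : Prop :=
  forall i (A : set (Rvec (d i))), measurable A ->
    pi [set x | A (blk x i)] = nu i A.

Definition is_density (pi P : {measure set (Rvec Dtot) -> \bar R})
  (f : Rvec Dtot -> R) : Prop :=
  [/\ measurable_fun setT f, (forall x, 0 <= f x)
    & forall A, measurable A -> pi A = (\int[P]_(x in A) (f x)%:E)%E].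

(** Divergence-regularized multi-marginal OT:
    OT_phi(nu) = inf_{pi coupling} \int c dpi + D_phi(pi, nu_1 (x)...(x) nu_N),
    where D_phi(pi,P) = \int phi(dpi/dP) dP if pi << P and +oo otherwise
    (couplings not absolutely continuous contribute +oo, hence may be
    omitted from the infimum).  The cost c is given on the set X. *)
Definition OTphi (phi : R -> R) (c : 'rV[R]_Dtot -> R) (X : set (Rvec Dtot))
  (nu : forall i, set (Rvec (d i)) -> \bar R) : \bar R :=
  ereal_inf [set z | exists (P : {measure set (Rvec Dtot) -> \bar R})
                            (pi : probability (Rvec Dtot) R)
                            (f : Rvec Dtot -> R),
      [/\ is_prod_meas P nu, is_coupling pi nu, is_density pi P f
        & z = (\int[pi]_(x in X) (c x)%:E + \int[P]_x (phi (f x))%:E)%E]].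

End Product.

Definition empirical (m n : nat) (y : 'I_n -> Rvec m) : set (Rvec m) -> \bar R :=
  fun A => (n%:R^-1 * \sum_(k < n) \1_A (y k))%:E.

Definition mutually_indep (dO : measure_display) (Om : measurableType dO)
  (PO : probability Om R) (N : nat) (d : 'I_N -> nat) (n : nat)
  (Y : forall i, 'I_n -> Om -> Rvec (d i)) : Prop :=
  forall A : forall i, 'I_n -> set (Rvec (d i)),
    (forall i k, measurable (A i k)) ->
    PO [set w | forall i k, A i k (Y i k w)] =
      \big[*%E/1%E]_(i < N) \big[*%E/1%E]_(k < n) PO (Y i k @^-1` A i k).

Definition strictly_convex_on (I : set R) (f : R -> R) : Prop :=
  forall x y t, I x -> I y -> x != y -> 0 < t < 1 ->
    f (t * x + (1 - t) * y) < t * f x + (1 - t) * f y.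

(** (phi, psi) convex conjugates; phi : R_+ -> R is represented by its
    values on [0, +oo). *)
Definition conv_conjugates (phi psi : R -> R) : Prop :=
  [/\ strictly_convex_on [set x | 0 <= x] phi,
      (exists m : R, forall x, 0 <= x -> m <= phi x),
      phi 1 = 0,
      (fun x => phi x / x) x @[x --> +oo] --> +oo
    & forall y, (psi y)%:E = ereal_sup [set (x * y - phi x)%:E | x in [set x | 0 <= x]]].

Definition dual_regular (psi : R -> R) : Prop :=
  [/\ (forall x, derivable psi x 1), continuous (derive1 psi),
      (exists C : R, 0 < C /\ forall x, C <= x -> x <= (derive1 psi) x)
    & exists x0 delta : R, [/\ 0 <= x0, 0 <= delta, (derive1 psi) x0 = 1
        & strictly_convex_on [set x | x0 - delta <= x] psi]].

Definition Cs1 (s : nat) (f : R -> R) : Prop :=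
  [/\ (forall k, (k < s)%N -> forall x, derivable ((derive1n k f)) x 1),
      (forall k, (k <= s)%N -> continuous ((derive1n k f)))
    & exists L : R, forall x y, `|(derive1n s f) x - (derive1n s f) y| <= L * `|x - y|].

Fixpoint iterD (V : normedModType R) (vs : seq V) (g : V -> R) : V -> R :=
  match vs with
  | [::] => g
  | v :: vs' => 'D_v (iterD vs' g)
  end.

Definition Cs_on (V : normedModType R) (U : set V) (s : nat) (g : V -> R) : Prop :=
  (forall vs : seq V, (size vs < s)%N -> forall v x, U x -> derivable (iterD vs g) x v) /\
  (forall vs : seq V, (size vs <= s)%N -> forall x, U x -> {for x, continuous (iterD vs g)}).

Definition Cs_set (V : normedModType R) (X : set V) (s : nat) (c : V -> R) : Prop :=
  exists (U : set V) (g : V -> R), [/\ open U, X `<=` U, Cs_on U s g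
    & forall x, X x -> g x = c x].

End Defs.

(* Main.v *)
(** Bounded dual potentials that nearly maximize the population dual pin down
    the optimal value for the population and for the empirical measures alike,
    at the parametric rate [n ^ (- 1/2)], which beats [n ^ (- s / d_mu)] because
    [2 s < d_mu]; no chaining over smoothness classes is needed (for [s = 0]
    boundedness of the optimal values suffices).

    For potentials [h] put [f = psi'(sum_i h_i - c)] and let [D(h)] be the dual
    value. Weak duality gives [OT >= D(h)]. If the marginal densities of [f] with
    respect to the product measure are within [t] of 1 in L2, then [f] can be
    corrected into a coupling whose cost exceeds [D(h)] by at most [C t]: only the
    quadratic growth of [phi], dual to [psi'(x) >= x], is used. Clipping
    potentials one at a time never decreases [D], so a nearly optimal [h] may be
    taken bounded by a constant independent of [n]; as [psi'] is locally
    Lipschitz, near-optimality forces the population marginal defect of [f] to be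
    small. For this fixed [h] the empirical defect and the fluctuation of [D(h)]
    are V-statistics, of second moment [O(1/n)] since all but a fraction [N/n] of
    the pairs of multi-indices share no sample. *)
Require Import Defs.
From HB Require Import structures.
From mathcomp Require Import all_boot all_order all_algebra.
From mathcomp Require Import all_classical all_reals all_analysis.
From mathcomp Require Import measurable_realfun ring lra.
Set Implicit Arguments. Unset Strict Implicit. Unset Printing Implicit Defensive.
Import Order.TTheory GRing.Theory Num.Theory.
Import numFieldNormedType.Exports.
Local Open Scope classical_set_scope.
Local Open Scope ring_scope.

(** * Bounded measurable functions, the class of all potentials and densities built below *)

Section BoundedMeasurable.
Context d (T : measurableType d) (R : realType).
Implicit Types f g : T -> R.

(** The potentials are fixed before sampling, so only fluctuations of finitely many fixed functions
    have to be estimated, never a supremum over potentials. The price is a primal competitor for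
    each measure: the optimal value is an infimum over exact couplings, while [psi'(pot)] has only
    approximate marginals. The additive repair [rho] takes over a weight [al] given up by
    [psi'(pot)], and convexity with quadratic growth prices it at about [K rho^2 / al]. Keeping
    [al >= t] while [rho] is of order [t] in L2 makes this price of order [t]. Hence defects are
    measured in L2, and the weight given up is at least [t] even where the defects vanish. Product
    structure enters through [mix], which keeps one block of a point and takes the others from an
    independent copy. This preserves population and empirical products alike, so one stability
    estimate serves both. *)

Definition bm f := measurable_fun setT f /\ exists M, forall x, `|f x| <= M.

Lemma bm_cst (r : R) : bm (fun=> r).
Proof. by split => //; exists `|r|. Qed.

Lemma bm_le f : bm f -> exists M, 0 <= M /\ forall x, `|f x| <= M.
Proof.
move=> [_ [M Mf]]; exists (Num.max M 0); split; first by rewrite le_max lexx orbT.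
by move=> x; rewrite le_max Mf.
Qed.

Lemma bmD f g : bm f -> bm g -> bm (fun x => f x + g x).
Proof.
move=> [mf [M Mf]] [mg [L Lg]]; split; first exact: measurable_funD.
by exists (M + L) => x; rewrite (le_trans (ler_normD _ _))// lerD.
Qed.

Lemma bmN f : bm f -> bm (fun x => - f x).
Proof.
move=> [mf [M Mf]]; split; first exact: measurableT_comp.
by exists M => x; rewrite normrN.
Qed.

Lemma bmB f g : bm f -> bm g -> bm (fun x => f x - g x).
Proof. by move=> bf bg; apply: bmD => //; exact: bmN. Qed.

Lemma bmM f g : bm f -> bm g -> bm (fun x => f x * g x).
Proof.
move=> [mf [M Mf]] [mg [L Lg]]; split; first exact: measurable_funM.
by exists (M * L) => x; rewrite normrM ler_pM.
Qed.

Lemma bmZ (r : R) f : bm f -> bm (fun x => r * f x).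
Proof. by move=> bf; apply: bmM => //; exact: bm_cst. Qed.

Lemma bmX f n : bm f -> bm (fun x => f x ^+ n).
Proof.
move=> bf; elim: n => [|n IH]; first exact: bm_cst.
by under eq_fun do rewrite exprS; exact: bmM.
Qed.

Lemma bm_max f g : bm f -> bm g -> bm (fun x => Num.max (f x) (g x)).
Proof.
move=> [mf [M Mf]] [mg [L Lg]]; split; first exact: measurable_maxr.
exists (Num.max M L) => x; rewrite le_max.
by case: (leP (f x) (g x)) => _; rewrite ?Mf ?Lg ?orbT.
Qed.

Lemma bm_min f g : bm f -> bm g -> bm (fun x => Num.min (f x) (g x)).
Proof.
move=> [mf [M Mf]] [mg [L Lg]]; split; first exact: measurable_minr.
exists (Num.max M L) => x; rewrite le_max.
by case: (leP (f x) (g x)) => _; rewrite ?Mf ?Lg ?orbT.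
Qed.

Lemma bm_abs f : bm f -> bm (fun x => `|f x|).
Proof.
move=> [mf [M Mf]]; split; first exact: measurableT_comp.
by exists M => x; rewrite normr_id.
Qed.

Lemma bm_sum (I : Type) (r : seq I) (F : I -> T -> R) :
  (forall i, bm (F i)) -> bm (fun x => \sum_(i <- r) F i x).
Proof.
move=> bF; elim: r => [|i r IH].
  by under eq_fun do rewrite big_nil; exact: bm_cst.
by under eq_fun do rewrite big_cons; exact: bmD.
Qed.

Lemma bm_prod (I : Type) (r : seq I) (F : I -> T -> R) :
  (forall i, bm (F i)) -> bm (fun x => \prod_(i <- r) F i x).
Proof.
move=> bF; elim: r => [|i r IH].
  by under eq_fun do rewrite big_nil; exact: bm_cst.
by under eq_fun do rewrite big_cons; exact: bmM.
Qed.

Lemma bm_indic (A : set T) : measurable A -> bm (\1_A : T -> R).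
Proof.
move=> mA; split => //; exists 1 => x; rewrite indicE.
by case: (x \in A); rewrite ?normr0 ?normr1.
Qed.

Lemma bm_comp (phi : R -> R) f : continuous phi -> {homo phi : x y / x <= y} ->
  bm f -> bm (fun x => phi (f x)).
Proof.
move=> cphi nd [mf [M Mf]]; split.
  by apply: measurableT_comp => //; exact: continuous_measurable_fun.
exists (Num.max `|phi M| `|phi (- M)|) => x.
have := Mf x; rewrite ler_norml => /andP[l u].
rewrite le_max; have [p0|p0] := leP 0 (phi (f x)).
  by rewrite (ger0_norm p0) (le_trans (nd _ _ u) (ler_norm _)).
apply/orP; right; rewrite ltr0_norm//.
by rewrite -normrN (le_trans _ (ler_norm _))// lerN2; exact: nd.
Qed.

End BoundedMeasurable.

Lemma bm_precomp d d' (S : measurableType d') (T : measurableType d)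
  (R : realType) (u : S -> T) (f : T -> R) :
  measurable_fun setT u -> bm f -> bm (fun x => f (u x)).
Proof.
move=> mu [mf [M Mf]]; split; first exact: (measurableT_comp mf).
by exists M.
Qed.

Section IntegralMonotone.
Context d (T : measurableType d) (R : realType).
Variable mu : {measure set T -> \bar R}.
Local Open Scope ereal_scope.

(* The integral of a nonnegative function is a supremum over simple minorants,
   so monotonicity requires no measurability. *)
Lemma le_integral_any (f g : T -> \bar R) :
  (forall x, f x <= g x) -> \int[mu]_x f x <= \int[mu]_x g x.
Proof.
move=> fg; rewrite /integral !patch_setT; apply: leeB; apply: ereal_sup_le => _ [h hf <-];
  exists h => // x; apply: le_trans (hf x) _.
- by rewrite /= !funeposE ge_max le_max (fg x)/= le_max lexx orbT.
- by rewrite /= !funenegE ge_max le_max leeN2 (fg x)/= le_max lexx orbT.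
Qed.

End IntegralMonotone.

(** * Expectations of bounded functions, change of variables and Fubini *)

Section Expectation.
Context d (T : measurableType d) (R : realType) (P : probability T R).
Implicit Types f g : T -> R.

Lemma bm_integrable f : bm f -> P.-integrable setT (EFin \o f).
Proof.
move=> [mf [M Mf]]; apply: measurable_bounded_integrable => //.
  by rewrite [ltLHS]probability_setT ltry.
exists M; split => [|x Mx y _]; first exact: num_real.
exact: le_trans (Mf y) (ltW Mx).
Qed.

Lemma EFin_E f : bm f -> (\int[P]_x (f x)%:E)%E = (\int[P]_x f x)%R%:E.
Proof.
move=> bf; rewrite /Rintegral fineK//.
by apply: integrable_fin_num => //; exact: bm_integrable.
Qed.

Lemma ED f g : bm f -> bm g ->
  \int[P]_x (f x + g x) = \int[P]_x f x + \int[P]_x g x.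
Proof. by move=> bf bg; rewrite RintegralD//; exact: bm_integrable. Qed.

Lemma EB f g : bm f -> bm g ->
  \int[P]_x (f x - g x) = \int[P]_x f x - \int[P]_x g x.
Proof. by move=> bf bg; rewrite RintegralB//; exact: bm_integrable. Qed.

Lemma EZ (r : R) f : bm f -> \int[P]_x (r * f x) = r * \int[P]_x f x.
Proof. by move=> bf; rewrite RintegralZl//; exact: bm_integrable. Qed.

Lemma Ecst (r : R) : \int[P]_x r = r.
Proof. by rewrite Rintegral_cst// [X in fine X]probability_setT/= mulr1. Qed.

Lemma Ele f g : bm f -> bm g -> (forall x, f x <= g x) ->
  \int[P]_x f x <= \int[P]_x g x.
Proof. by move=> bf bg fg; apply: le_Rintegral => //; exact: bm_integrable. Qed.

Lemma eq_E f g : f =1 g -> \int[P]_x f x = \int[P]_x g x.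
Proof. by move=> /funext ->. Qed.

Lemma Esum (I : Type) (r : seq I) (F : I -> T -> R) :
  (forall i, bm (F i)) ->
  \int[P]_x (\sum_(i <- r) F i x) = \sum_(i <- r) \int[P]_x F i x.
Proof.
move=> bF; elim: r => [|i r IH].
  by rewrite big_nil; under eq_E do rewrite big_nil; exact: Ecst.
rewrite big_cons -IH -ED//; last exact: bm_sum.
by apply: eq_E => x; rewrite big_cons.
Qed.

End Expectation.

Lemma E_pushforward d d' (S : measurableType d') (T : measurableType d)
  (R : realType) (Q : probability S R) (P : probability T R) (u : S -> T) (f : T -> R) :
  measurable_fun setT u ->
  (forall A, measurable A -> P A = Q (u @^-1` A)) -> bm f ->
  \int[P]_x f x = \int[Q]_x f (u x).
Proof.
move=> mu PQ bf; rewrite /Rintegral; congr fine.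
transitivity (\int[pushforward Q u]_x (f x)%:E)%E.
  by apply: eq_measure_integral => A mA _; exact: PQ.
rewrite integral_pushforward//; first by apply/measurable_EFinP; case: bf.
by have := bm_integrable Q (bm_precomp mu bf).
Qed.

Section Fubini.
Context d d' (S : measurableType d') (T : measurableType d) (R : realType)
  (Q : probability S R) (P : probability T R).

Lemma bm_fubini (F : S * T -> R) : bm F -> bm (fun x => \int[P]_y F (x, y)).
Proof.
move=> bF; have iF := bm_integrable (Q \x P)%E bF.
have sec x : bm (fun y => F (x, y)).
  by apply: (bm_precomp (u := fun y => (x, y))) bF; exact: measurable_fun_pair.
have [mF [M [M0 MF]]] : measurable_fun setT F /\ exists M, 0 <= M /\ forall x, `|F x| <= M.
  by split; [case: bF | exact: bm_le].
split.
  apply/measurable_EFinP.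
  have := measurable_fubini_F iF; congr measurable_fun.
  by apply/funext => x; rewrite /fubini_F/= EFin_E.
exists M => x; apply: (le_trans (le_normr_Rintegral _ (bm_integrable P (sec x)))) => //.
rewrite -[leRHS](Ecst P); apply: Ele; [exact: bm_abs|exact: bm_cst|by move=> y].
Qed.

Lemma E_fubini (F : S * T -> R) : bm F ->
  \int[(Q \x P)%E]_z F z = \int[Q]_x \int[P]_y F (x, y).
Proof.
move=> bF; have iF := bm_integrable (Q \x P)%E bF.
rewrite /Rintegral -(integral12_prod_meas1 iF); congr fine.
apply: eq_integral => x _; rewrite /fubini_F/= EFin_E//.
by apply: (bm_precomp (u := fun y => (x, y))) bF; exact: measurable_fun_pair.
Qed.

End Fubini.

(** * Measures given by a density *)

Section Density.
Context d (T : measurableType d) (R : realType) (P : {measure set T -> \bar R}).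
Variable f : T -> R.
Hypotheses (mf : measurable_fun setT f) (f0 : forall x, 0 <= f x).
Local Open Scope ereal_scope.

Definition density_measure (A : set T) : \bar R := \int[P]_(x in A) (f x)%:E.

Let density_measure0 : density_measure set0 = 0.
Proof. by rewrite /density_measure integral_set0. Qed.

Let density_measure_ge0 A : 0 <= density_measure A.
Proof. by apply: integral_ge0 => x _; rewrite lee_fin. Qed.

Let density_measure_sigma : semi_sigma_additive density_measure.
Proof.
move=> /= F mF tF mUF; rewrite /density_measure; apply: cvg_toP.
  apply: ereal_nondecreasing_is_cvgn => m n mn.
  by apply: lee_sum_nneg_natr => // k _ _; exact: density_measure_ge0.
rewrite ge0_integral_bigcup//=.
- by apply: measurable_funTS; exact: measurableT_comp.
- by move=> x _; rewrite lee_fin.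
Qed.

HB.instance Definition _ := isMeasure.Build _ _ _ density_measure
  density_measure0 density_measure_ge0 density_measure_sigma.

Hypothesis f1 : density_measure setT = 1.

HB.instance Definition _ := @Measure_isProbability.Build _ _ R
  density_measure f1.

Lemma density_measure_probability : exists Q : probability T R,
  forall A, measurable A -> Q A = density_measure A.
Proof. by exists [the probability T R of density_measure]. Qed.

Import HBNNSimple.

(** Both sides are monotone limits along simple approximations of [g], and on the indicator of a
    level set the identity is the hypothesis on [Q]. *)
Lemma ge0_integral_density (Q : {measure set T -> \bar R}) (g : T -> \bar R) :
  (forall A, measurable A -> Q A = \int[P]_(x in A) (f x)%:E) ->
  measurable_fun setT g -> (forall x, 0 <= g x) ->
  \int[Q]_x g x = \int[P]_x (g x * (f x)%:E).
Proof.
move=> QE mg g0; pose h := nnsfun_approx measurableT mg.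
have mfE : measurable_fun setT (EFin \o f) by exact: measurableT_comp.
have gE x : g x = lim ((EFin \o h n) x @[n --> \oo]).
  by apply/esym/cvg_lim => //; exact: cvg_nnsfun_approx.
have mh n y : measurable (h n @^-1` [set y]).
  by rewrite -[X in measurable X]setTI; exact: measurable_funP.
have -> : \int[Q]_x g x = lim (\int[Q]_x (EFin \o h n) x @[n --> \oo]).
  under eq_integral do rewrite gE.
  apply: monotone_convergence => //.
  - by move=> n; apply/measurable_EFinP; exact: measurable_funP.
  - by move=> n x _ /=; rewrite lee_fin.
  - by move=> x _ a b ab; rewrite lee_fin; exact/lefP/nd_nnsfun_approx.
have -> : \int[P]_x (g x * (f x)%:E) =
    lim (\int[P]_x ((EFin \o h n) x * (f x)%:E) @[n --> \oo]).
  have fg x : g x * (f x)%:E = lim ((EFin \o h n) x * (f x)%:E @[n --> \oo]).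
    by apply/esym/cvg_lim => //; apply: cvgeZr => //; exact: cvg_nnsfun_approx.
  under eq_integral do rewrite fg.
  apply: monotone_convergence => //.
  - move=> n; apply: emeasurable_funM => //.
    by apply/measurable_EFinP; exact: measurable_funP.
  - by move=> n x _ /=; rewrite mule_ge0 ?lee_fin.
  - move=> x _ a b ab/=; rewrite lee_wpmul2r ?lee_fin//.
    exact/lefP/nd_nnsfun_approx.
apply: congr_lim; apply/funext => n.
transitivity (\int[Q]_x
   (\sum_(y \in range (h n)) (y * \1_(h n @^-1` [set y]) x)%:E)).
  by apply: eq_integral => t tE; rewrite /= fimfunE -fsumEFin.
rewrite ge0_integral_fsum//; last 2 first.
  - by move=> y; apply/measurable_EFinP; exact: measurable_funM.
  - by move=> y x _; exact: nnfun_muleindic_ge0.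
transitivity (\int[P]_x (\sum_(y \in range (h n))
    (y * \1_(h n @^-1` [set y]) x)%:E * (f x)%:E)); last first.
  apply: eq_integral => x _.
  rewrite -ge0_mule_fsuml => [|y]; last exact: nnfun_muleindic_ge0.
  by rewrite fsumEFin // -(fimfunE _ x).
rewrite ge0_integral_fsum//; last 2 first.
  - move=> y; apply: emeasurable_funM => //; apply/measurable_EFinP.
    exact: measurable_funM.
  - by move=> y x _; apply: mule_ge0; [exact: nnfun_muleindic_ge0|rewrite lee_fin].
apply: eq_fsbigr => r rhn.
under eq_integral do rewrite EFinM.
rewrite integralZl_indic_nnsfun//.
under [RHS]eq_integral do rewrite EFinM -muleA.
have r0 : (0 <= r)%R by move: rhn; rewrite inE => -[x _ <-].
rewrite ge0_integralZl//; last 2 first.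
- by apply: emeasurable_funM => //; apply/measurable_EFinP.
- by move=> x _; rewrite mule_ge0 ?lee_fin.
rewrite integral_indic// setIT QE// [in LHS]integral_mkcond.
congr (_ * _); apply: eq_integral => x _.
by rewrite epatch_indic muleC.
Qed.

(** Multiplication by the nonnegative [f] commutes with positive and negative parts, so the
    nonnegative case applies to each part, whether or not [g] is integrable. *)
Lemma integral_density (Q : {measure set T -> \bar R}) (g : T -> \bar R) :
  (forall A, measurable A -> Q A = \int[P]_(x in A) (f x)%:E) ->
  measurable_fun setT g ->
  \int[Q]_x g x = \int[P]_x (g x * (f x)%:E).
Proof.
move=> QE mg; rewrite integralE [RHS]integralE.
rewrite !(ge0_integral_density QE) ?funepos_ge0 ?funeneg_ge0//; last 2 first.
- exact: measurable_funeneg.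
- exact: measurable_funepos.
congr (_ - _); apply: eq_integral => x _; rewrite ?funeposE ?funenegE.
  by rewrite maxe_pMl ?lee_fin// mul0e.
by rewrite maxe_pMl ?lee_fin// mul0e mulNe.
Qed.

End Density.

Lemma density_probability d (T : measurableType d) (R : realType)
  (P : probability T R) (f : T -> R) :
  bm f -> (forall x, 0 <= f x) -> \int[P]_x f x = 1 ->
  exists Q : probability T R,
    forall A, measurable A -> Q A = (\int[P]_(x in A) (f x)%:E)%E.
Proof.
move=> bf f0 f1; apply: density_measure_probability => //; first by case: bf.
by rewrite /density_measure EFin_E// f1.
Qed.

(** * Borel sets of row vectors *)

Section BorelRowVectors.
Context (R : realType).

Lemma measurable_forall d (T : measurableType d) (I : finType) (A : I -> set T) :
  (forall i, measurable (A i)) -> measurable [set x | forall i, A i x].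
Proof.
move=> mA; rewrite (_ : mkset _ = \bigcap_(i in [set: I]) A i).
  exact: fin_bigcap_measurable.
by apply/seteqP; split => [x Ax i _|x Ax i]; apply: Ax.
Qed.

Definition ratbox n (q : {ffun 'I_n -> rat * rat}) : set 'rV[R]_n :=
  [set v | forall j, ratr (q j).1 < v 0 j /\ v 0 j < ratr (q j).2].

Lemma open_ratbox n (U : set 'rV[R]_n) v : open U -> U v ->
  exists q, ratbox q v /\ ratbox q `<=` U.
Proof.
move=> oU Uv; have : nbhs v U by exact: open_nbhs_nbhs.
move/nbhs_ballP => [e /= e0 eU].
have /choice[q qP] (j : 'I_n) : exists p : rat * rat,
    v 0 j - e < ratr p.1 < v 0 j /\ v 0 j < ratr p.2 < v 0 j + e.
  have h1 : v 0 j - e < v 0 j by rewrite ltrBlDr ltrDl.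
  have h2 : v 0 j < v 0 j + e by rewrite ltrDl.
  have [a] := rat_in_itvoo h1; have [b] := rat_in_itvoo h2.
  by rewrite !in_itv/= => hb ha; exists (a, b).
exists [ffun j => q j]; split.
  by move=> j; rewrite ffunE; have [/andP[_ ->] /andP[-> _]] := qP j.
move=> w wq; apply: eU; split=> // i j; rewrite (ord1 i).
have := wq j; rewrite ffunE /ball/= => -[h1 h2].
have [/andP[h3 h4] /andP[h5 h6]] := qP j.
by rewrite ltr_norml; apply/andP; split; lra.
Qed.

(** An open set is a countable union of boxes with rational corners, and the preimage of a box is a
    finite intersection of coordinate conditions. *)
Lemma measurable_fun_rV d (S : measurableType d) n (u : S -> Rvec R n) :
  (forall j, measurable_fun setT (fun s => (u s : 'rV[R]_n) 0 j)) ->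
  measurable_fun setT u.
Proof.
move=> mu; apply: (@measurability _ _ _ _ setT u open) => //.
move=> _ [U oU <-]; rewrite setTI.
(* [pickle] numbers the boxes; numbers that code no box, and boxes not inside [U], contribute the
   empty set. *)
pose F k := if unpickle k is Some q then
  [set s | @ratbox n q (u s) /\ @ratbox n q `<=` U] else set0.
rewrite (_ : _ @^-1` _ = \bigcup_k F k); last first.
  apply/seteqP; split=> s /=.
    move=> /(open_ratbox oU)[q qP]; exists (pickle q) => //.
    by rewrite /F pickleK.
  move=> [k _]; rewrite /F; case: unpickle => // q /= [qs]; exact.
apply: bigcupT_measurable => k; rewrite /F; case: unpickle => // q.
have [qU|qU] := pselect (@ratbox n q `<=` U); last first.
  rewrite (_ : mkset _ = set0)//; apply/seteqP; split => //.
  by move=> x /= [].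
rewrite (_ : mkset _ = [set s | forall j, (fun j : 'I_n =>
   (fun s => (u s : 'rV[R]_n) 0 j) @^-1` `]ratr (q j).1, ratr (q j).2[) j s]); last first.
  apply/seteqP; split=> s /=.
    by move=> [+ _] j; rewrite in_itv/= => /(_ j)[-> ->].
  by move=> h; split => // j; have := h j; rewrite in_itv/= => /andP.
apply: measurable_forall => j; rewrite -[X in measurable X]setTI.
exact: mu.
Qed.

Lemma continuous_measurable_rV n (f : 'rV[R]_n -> R) : continuous f ->
  measurable_fun setT (f : Rvec R n -> R).
Proof.
move=> cf; apply: (measurability _ (RGenOInfty.measurableE R)).
move=> _ [_ [a ->]] <-; rewrite setTI; apply: sub_sigma_algebra.
have /continuousP := cf; apply; rewrite set_itvE; exact: open_gt.
Qed.

Lemma measurable_coord n (j : 'I_n) :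
  measurable_fun setT (fun v : Rvec R n => (v : 'rV[R]_n) 0 j).
Proof. by apply: continuous_measurable_rV; exact: coord_continuous. Qed.

End BorelRowVectors.

(** * Blocks, measurable rectangles and mixing of points *)

Section Blocks.
Context (R : realType) (N : nat) (d : 'I_N -> nat).
Let T := Rvec R (Dtot d).

Definition joinT (y : forall i, Rvec R (d i)) : T := (\mxrow_i (y i : 'rV[R]_(d i)))%R.

Lemma blk_join (y : forall i, Rvec R (d i)) i : blk (joinT y) i = y i.
Proof. by rewrite /blk /joinT mxrowK. Qed.

Lemma join_blk (x : T) : joinT (fun i => blk x i) = x.
Proof. exact: submxrowK. Qed.

Lemma blk_inj (x z : T) : (forall i, blk x i = blk z i) -> x = z.
Proof.
by move=> xz; rewrite -(join_blk x) -(join_blk z); congr joinT; apply/functional_extensionality_dep.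
Qed.

Lemma blkE (x : T) i j : (blk x i : 'rV[R]_(d i)) 0 j =
  (x : 'rV[R]_(Dtot d)) 0 (@tagnat.Rank N d i j).
Proof. by rewrite /blk /submxrow mxE. Qed.

Lemma coord_blk (x : T) (k : 'I_(\sum_(i < N) d i)) : (x : 'rV[R]_(Dtot d)) 0 k =
  (blk x (tagnat.sig1 k) : 'rV[R]_(d (tagnat.sig1 k))) 0 (tagnat.sig2 k).
Proof. by rewrite blkE tagnat.sig2K. Qed.

Lemma measurable_blk i : measurable_fun setT (fun x : T => blk x i : Rvec R (d i)).
Proof.
apply: measurable_fun_rV => j; under eq_fun do rewrite blkE.
exact: measurable_coord.
Qed.

Lemma measurable_fun_blocks d0 (S : measurableType d0) (u : S -> T) :
  (forall i, measurable_fun setT (fun s => blk (u s) i : Rvec R (d i))) ->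
  measurable_fun setT u.
Proof.
move=> mu; apply: measurable_fun_rV => k; under eq_fun do rewrite coord_blk.
exact: (measurableT_comp (measurable_coord _) (mu _)).
Qed.

Definition rect (A : forall i, set (Rvec R (d i))) : set T :=
  [set x | forall i, A i (blk x i)].

Definition rects : set (set T) :=
  [set B | exists A, (forall i, measurable (A i)) /\ B = rect A].

Lemma measurable_rect A : (forall i, measurable (A i)) -> measurable (rect A).
Proof.
move=> mA; apply: (@measurable_forall _ T 'I_N (fun i => [set x : T | A i (blk x i)])) => i.
by rewrite -[X in measurable X]setTI; exact: measurable_blk.
Qed.

(** The nontrivial inclusion says that the identity out of the sigma-algebra of rectangles is
    measurable. This can be tested block by block, and a condition on one block is a rectangle with
    full sides elsewhere. *)
Lemma measurable_rects : (measurable : set (set T)) = <<s rects >>.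
Proof.
apply/seteqP; split; last first.
  apply: smallest_sub; first exact: sigma_algebra_measurable.
  by move=> _ [A [mA ->]]; exact: measurable_rect.
move=> A mA.
have mid : measurable_fun setT (id : g_sigma_algebraType rects -> T).
  apply: measurable_fun_blocks => i _ B mB; rewrite setTI.
  apply: sub_sigma_algebra.
  (* [B] lives in the type of block [i], so the side at [j] is [B] transported along a proof of
     [i = j]. *)
  exists (fun j => if pselect (i = j) is left e then
    ecast j (set (Rvec R (d j))) e B else setT); split.
    by move=> j; case: pselect => // e; case: _ / e.
  apply/seteqP; split=> x /=.
    by move=> Bx j; case: pselect => // e; case: _ / e.
  by move=> /(_ i); case: pselect => // e; rewrite (Prop_irrelevance e erefl).
by have := mid measurableT A mA; rewrite setTI.
Qed.

(** Rectangles are stable under intersection, generate the sigma-algebra and include the whole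
    space, where [P] is finite. *)
Lemma rect_unique (P Q : {measure set T -> \bar R}) : (P setT < +oo)%E ->
  (forall A, (forall i, measurable (A i)) -> P (rect A) = Q (rect A)) ->
  forall B, measurable B -> P B = Q B.
Proof.
move=> Pfin PQ.
have rT : rects setT.
  exists (fun=> setT); split; first by move=> i; exact: measurableT.
  by apply/seteqP; split.
apply: (measure_unique rects (fun=> setT)) => //.
- exact: measurable_rects.
- move=> _ _ [A [mA ->]] [B [mB ->]]; exists (fun i => A i `&` B i); split.
    by move=> i; exact: measurableI.
  apply/seteqP; split=> x /=; first by move=> [a b] i; split; [exact: a|exact: b].
  by move=> ab; split=> i; have [] := ab i.
- by apply/seteqP; split => // x _; exists 0%N.
- by move=> _ [A [mA ->]]; exact: PQ.
Qed.

Lemma prod_meas_unique (P Q : {measure set T -> \bar R}) nu :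
  is_prod_meas P nu -> is_prod_meas Q nu -> (P setT < +oo)%E ->
  forall B, measurable B -> P B = Q B.
Proof.
move=> Pnu Qnu Pfin; apply: rect_unique => // A mA.
by rewrite [LHS](Pnu A mA) [RHS](Qnu A mA).
Qed.

(** Averaging over [z] amounts to conditioning on block [i]; the independence of blocks is expressed
    through this operation. *)
Definition mix (i : 'I_N) (x z : T) : T :=
  joinT (fun j => if j == i then blk x j else blk z j).

Lemma blk_mix i x z j : blk (mix i x z) j = if j == i then blk x j else blk z j.
Proof. by rewrite blk_join. Qed.

Lemma mixl i x z u : mix i (mix i x z) u = mix i x u.
Proof. by apply: blk_inj => j; rewrite !blk_mix; case: eqP. Qed.

Lemma mixr i j x z u : i != j -> mix j (mix i x z) u = mix j z u.
Proof.
move=> ij; apply: blk_inj => k; rewrite !blk_mix.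
by case: eqP => // ->; rewrite eq_sym (negbTE ij).
Qed.

Lemma measurable_mix i : measurable_fun setT (fun p : T * T => mix i p.1 p.2).
Proof.
apply: measurable_fun_blocks => j; under eq_fun do rewrite blk_mix.
case: eqP => _.
  exact: (measurableT_comp (@measurable_blk j) measurable_fst).
exact: (measurableT_comp (@measurable_blk j) measurable_snd).
Qed.

(** The preimage of a rectangle is a product of two rectangles, the first constraining block [i]
    only and the second all other blocks; their masses multiply to the mass of the original. *)
Lemma mix_measure_preserving i (P : probability T R) nu : is_prod_meas P nu ->
  (forall j, nu j setT = 1%E) ->
  forall A, measurable A -> P A = (P \x P)%E ((fun p => mix i p.1 p.2) @^-1` A).
Proof.
move=> Pnu nu1.
have mm := @measurable_mix i.
suff : forall A, measurable A -> P A = pushforward (P \x P)%E (fun p => mix i p.1 p.2) A by [].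
apply: rect_unique => [|A mA]; first by rewrite [ltLHS]probability_setT ltry.
rewrite /= /pushforward.
rewrite (_ : _ @^-1` _ = rect (fun j => if j == i then A j else setT) `*`
   rect (fun j => if j == i then setT else A j)); last first.
  apply/seteqP; split=> -[x z]; rewrite /rect/=.
    move=> h; split=> j; have := h j; rewrite blk_mix; by case: eqP.
  by move=> [h1 h2] j; have := h1 j; have := h2 j; rewrite blk_mix; case: eqP.
rewrite product_measure1E; [|apply: measurable_rect => j; case: eqP => // _; exact: measurableT..].
rewrite [LHS]Pnu// [X in (_ = X * _)%E]Pnu ?[X in (_ = _ * X)%E]Pnu;
  [|by move=> j; case: eqP => // _; exact: measurableT..].
rewrite -big_split/=; apply: eq_bigr => j _.
by case: eqP => _; rewrite nu1 ?mule1 ?mul1e.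
Qed.

End Blocks.

(** * Conditional expectation given one block *)

Section BlockExpectation.
Context d (T : measurableType d) (R : realType) (I : finType).
Implicit Types (f g k : T -> R) (i : I).
Variable mix : I -> T -> T -> T.
Hypothesis mmix : forall i, measurable_fun setT (fun p : T * T => mix i p.1 p.2).
Hypothesis mixl : forall i x z u, mix i (mix i x z) u = mix i x u.
Hypothesis mixr : forall i j x z u, i != j -> mix j (mix i x z) u = mix j z u.
Variable P : probability T R.
Hypothesis mixP : forall i A, measurable A ->
  P A = (P \x P)%E ((fun p => mix i p.1 p.2) @^-1` A).

(** A function of block [i] alone stays a function on the whole space; the restriction is an
    invariance under replacing the other blocks. *)
Definition dep (i : I) (k : T -> R) := forall x z, k (mix i x z) = k x.
Definition indep (i : I) (k : T -> R) := forall x z, k (mix i x z) = k z.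

Definition Eblk (i : I) (f : T -> R) (x : T) := \int[P]_z f (mix i x z).

Lemma bm_mix i f : bm f -> bm (fun p : T * T => f (mix i p.1 p.2)).
Proof. exact: bm_precomp. Qed.

Lemma bm_mixr i f x : bm f -> bm (fun z => f (mix i x z)).
Proof.
move=> bf; apply: (bm_precomp (u := fun z => mix i x z)) bf.
apply: (measurableT_comp (mmix i) (g := fun z => (x, z))).
exact: measurable_fun_pair.
Qed.

Lemma bm_Eblk i f : bm f -> bm (Eblk i f).
Proof. by move=> bf; exact: (bm_fubini P P (bm_mix i bf)). Qed.

(** The tower property: two independent points mixed at block [i] have law [P] again. *)
Lemma E_Eblk i f : bm f -> \int[P]_x Eblk i f x = \int[P]_x f x.
Proof.
move=> bf; rewrite [RHS](E_pushforward (u := fun p => mix i p.1 p.2) (Q := (P \x P)%E))//.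
- by rewrite (E_fubini _ _ (bm_mix i bf)).
- exact: mixP.
Qed.

Lemma dep_Eblk i f : dep i (Eblk i f).
Proof. by move=> x z; rewrite /Eblk; apply: eq_E => u; rewrite mixl. Qed.

Lemma indep_dep i j k : i != j -> dep j k -> indep i k.
Proof. by move=> ij dk x z; rewrite -(dk (mix i x z) z) mixr// dk. Qed.

Lemma Eblk_depM i k f x : bm f -> dep i k ->
  Eblk i (fun x => k x * f x) x = k x * Eblk i f x.
Proof.
move=> bf dk; rewrite /Eblk -EZ; last exact: bm_mixr.
by apply: eq_E => z; rewrite dk.
Qed.

Lemma Eblk_dep i k x : dep i k -> Eblk i k x = k x.
Proof.
by move=> dk; rewrite /Eblk -[RHS](Ecst P); apply: eq_E => z; rewrite dk.
Qed.

Lemma E_depM i k f : bm k -> bm f -> dep i k ->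
  \int[P]_x (k x * f x) = \int[P]_x (k x * Eblk i f x).
Proof.
move=> bk bf dk; rewrite -(E_Eblk i); last exact: bmM.
by apply: eq_E => x; rewrite Eblk_depM.
Qed.

Lemma Eblk_indep i k x : indep i k -> Eblk i k x = \int[P]_z k z.
Proof. by move=> dk; rewrite /Eblk; apply: eq_E => z; rewrite dk. Qed.

Lemma E_indepM i k f : bm k -> bm f -> dep i k -> indep i f ->
  \int[P]_x (k x * f x) = \int[P]_x k x * \int[P]_x f x.
Proof.
move=> bk bf dk df; rewrite (E_depM bk bf dk) mulrC -EZ//.
by apply: eq_E => x; rewrite Eblk_indep// mulrC.
Qed.

Lemma EblkD i f g x : bm f -> bm g ->
  Eblk i (fun x => f x + g x) x = Eblk i f x + Eblk i g x.
Proof. by move=> bf bg; rewrite /Eblk ED//; exact: bm_mixr. Qed.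

Lemma EblkB i f g x : bm f -> bm g ->
  Eblk i (fun x => f x - g x) x = Eblk i f x - Eblk i g x.
Proof. by move=> bf bg; rewrite /Eblk EB//; exact: bm_mixr. Qed.

Lemma EblkZ i r f x : bm f -> Eblk i (fun x => r * f x) x = r * Eblk i f x.
Proof. by move=> bf; rewrite /Eblk EZ//; exact: bm_mixr. Qed.

Lemma Eblk_le i f g x : bm f -> bm g -> (forall x, f x <= g x) ->
  Eblk i f x <= Eblk i g x.
Proof. by move=> bf bg fg; apply: Ele => [||z]; [exact: bm_mixr..|exact: fg]. Qed.

Lemma indep_prod i (r : seq I) (k : I -> T -> R) : i \notin r ->
  (forall j, dep j (k j)) -> indep i (fun x => \prod_(j <- r) k j x).
Proof.
move=> ir dk x z; rewrite big_seq [RHS]big_seq; apply: eq_bigr => j jr.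
by apply: (indep_dep _ (dk j)); apply: contraNneq ir => ->.
Qed.

Lemma E_prod (r : seq I) (k : I -> T -> R) : uniq r ->
  (forall j, bm (k j)) -> (forall j, dep j (k j)) ->
  \int[P]_x (\prod_(j <- r) k j x) = \prod_(j <- r) \int[P]_x k j x.
Proof.
move=> ur bk dk; elim: r ur => [|i r IH] /=.
  by move=> _; rewrite big_nil; under eq_E do rewrite big_nil; exact: Ecst.
move=> /andP[ir ur]; rewrite big_cons -IH//.
rewrite -(E_indepM (i := i))//.
- by apply: eq_E => x; rewrite big_cons.
- exact: bm_prod.
- exact: indep_prod.
Qed.

(** Factor [i] is frozen and the others are independent of it. With factors of mean 1, the product
    has the factors themselves as block marginals, which is how [rho] below is built. *)
Lemma Eblk_prod i (k : I -> T -> R) x :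
  (forall j, bm (k j)) -> (forall j, dep j (k j)) ->
  Eblk i (fun x => \prod_j k j x) x = k i x * \prod_(j | j != i) \int[P]_x k j x.
Proof.
move=> bk dk; pose r := [seq j <- index_enum I | j != i].
have ir : i \notin r by rewrite mem_filter eqxx.
have ur : uniq r by rewrite filter_uniq// index_enum_uniq.
rewrite -big_filter -/r -E_prod// -(Eblk_indep (i := i) x); last exact: indep_prod.
rewrite -Eblk_depM//; last exact: bm_prod.
by apply: eq_E => z; rewrite (bigD1 i)//= /r big_filter.
Qed.

Lemma indep_sum (r : seq I) (k : I -> T -> R) : (forall j, dep j (k j)) ->
  forall i, indep i (fun x => \sum_(j <- r | j != i) k j x).
Proof.
move=> dk i x z; apply: eq_bigr => j ji.
by apply: (indep_dep _ (dk j)); rewrite eq_sym.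
Qed.

(** * Repairing approximate marginals *)

Section Correction.
Variables (f : T -> R) (A t : R).
Hypotheses (bf : bm f) (f0 : forall x, 0 <= f x) (fA : forall x, f x <= A).
Hypotheses (t0 : 0 < t) (t1 : t <= 1) (I0 : (0 < #|I|)%N).
Let m i := Eblk i f.
Let e i := fun x => m i x - 1.
Hypothesis et : forall i, \int[P]_x e i x ^+ 2 <= t ^+ 2.

Let n : R := #|I|%:R.

Let n0 : 0 <= n. Proof. exact: ler0n. Qed.

(** Bounds the second moment of a deficit in units of [t ^ 2]: the bound [r_le] is squared with
    [(p + q)^2 <= 2 p^2 + 2 q^2]. *)
Definition corr_cst : R := 2 * (1 + A) ^+ 2 + 2 * (1 + A * n) ^+ 2.

Let A0 : 0 <= A. Proof. by rewrite (le_trans (f0 point) (fA point)). Qed.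

Let C1 := corr_cst.

Let C1ge : 1 <= C1.
Proof.
rewrite /C1 /corr_cst; have := mulr_ge0 A0 n0.
have := A0; set z := A * n => h1 h2; nra.
Qed.

Let bm_m i : bm (m i). Proof. exact: bm_Eblk. Qed.
Let bm_e i : bm (e i). Proof. by apply: bmB => //; exact: bm_cst. Qed.
Let bm_ae i : bm (fun x => `|e i x|). Proof. exact: bm_abs. Qed.
Let dep_ae i : dep i (fun x => `|e i x|).
Proof. by move=> x z; rewrite /e /m dep_Eblk. Qed.

(** Integrates [k <= k^2 / (2 t) + t / 2], a substitute for the Cauchy-Schwarz inequality. *)
Lemma E_le_of_sq (k : T -> R) (u : R) : bm k -> \int[P]_x k x ^+ 2 <= u * t ^+ 2 ->
  \int[P]_x k x <= (u + 1) / 2 * t.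
Proof.
move=> bk h.
apply: (@le_trans _ _ (\int[P]_x ((2 * t)^-1 * k x ^+ 2 + t / 2))).
  apply: Ele => //; first by apply: bmD; [apply: bmZ; exact: bmX|exact: bm_cst].
  move=> x; rewrite -subr_ge0.
  have -> : (2 * t)^-1 * k x ^+ 2 + t / 2 - k x = (2 * t)^-1 * (k x - t) ^+ 2.
    by field; rewrite gt_eqF.
  by rewrite mulr_ge0 ?sqr_ge0// invr_ge0 mulr_ge0// ltW.
rewrite ED; [|by apply: bmZ; exact: bmX|exact: bm_cst].
rewrite Ecst EZ; last exact: bmX.
have : (2 * t)^-1 * \int[P]_x k x ^+ 2 <= (2 * t)^-1 * (u * t ^+ 2).
  by rewrite ler_wpM2l// invr_ge0 mulr_ge0// ltW.
have -> : (2 * t)^-1 * (u * t ^+ 2) = u / 2 * t by field; rewrite gt_eqF.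
lra.
Qed.

Let Eae i : \int[P]_x `|e i x| <= t.
Proof.
have -> : t = (1 + 1) / 2 * t :> R by field.
apply: E_le_of_sq => //; rewrite mul1r.
by under eq_E do rewrite -normrX ger0_norm ?sqr_ge0//.
Qed.

Let a x := \sum_j `|e j x|.
Let w x := Num.max 0 (1 - a x).
Let G x := f x * w x.
Let al x := 1 - (1 - t) * w x.
Let r i x := 1 - (1 - t) * Eblk i G x.
Let M := 1 - (1 - t) * \int[P]_x G x.
Let rho x := M * \prod_i (r i x / M).

Let a0 x : 0 <= a x. Proof. by apply: sumr_ge0. Qed.
Let bm_a : bm a. Proof. exact: bm_sum. Qed.
Let bm_w : bm w.
Proof. by apply: bm_max; [exact: bm_cst|apply: bmB => //; exact: bm_cst]. Qed.
Let bm_G : bm G. Proof. exact: bmM. Qed.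
Let bm_al : bm al.
Proof. by apply: bmB; [exact: bm_cst|exact: bmZ]. Qed.
Let bm_r i : bm (r i).
Proof. by apply: bmB; [exact: bm_cst|apply: bmZ; exact: bm_Eblk]. Qed.
Let bm_rM i : bm (fun x => r i x / M).
Proof. by apply: bmM => //; exact: bm_cst. Qed.
Let bm_rho : bm rho. Proof. by apply: bmZ; exact: bm_prod. Qed.
Let dep_r i : dep i (r i). Proof. by move=> x z; rewrite /r dep_Eblk. Qed.
Let dep_rM i : dep i (fun x => r i x / M). Proof. by move=> x z; rewrite dep_r. Qed.

Let w01 x : 0 <= w x <= 1.
Proof. by rewrite /w le_max lexx/= ge_max ler01/= gerBl. Qed.

Let w1a x : 1 - w x <= a x.
Proof. by rewrite lerBlDr -lerBlDl /w le_max lexx orbT. Qed.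

Let G0 x : 0 <= G x.
Proof. by have /andP[w0 _] := w01 x; rewrite mulr_ge0. Qed.

Let EblkG0 i x : 0 <= Eblk i G x.
Proof. by apply: Rintegral_ge0 => z _; exact: G0. Qed.

(** The weight [w] is at most the positive part of [1 - |e i|], which depends on block [i] alone and
    leaves the conditional expectation. What remains is [(1 - |u|)^+ (1 + u) <= 1] with
    [u = e i x]. *)
Let EblkG1 i x : Eblk i G x <= 1.
Proof.
pose v x := Num.max 0 (1 - `|e i x|).
have bv : bm v.
  by apply: bm_max; [exact: bm_cst|apply: bmB => //; exact: bm_cst].
have dv : dep i v by move=> y z; rewrite /v dep_ae.
apply: (@le_trans _ _ (Eblk i (fun x => v x * f x) x)).
  apply: Eblk_le => //; first exact: bmM.
  move=> y; rewrite /G mulrC ler_wpM2r// /w /v ge_max !le_max lexx/=.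
  apply/orP; right; rewrite lerB//.
  by rewrite /a (bigD1 i)//= lerDl sumr_ge0.
rewrite Eblk_depM// -/(m i x).
have mi : 0 <= m i x by apply: Rintegral_ge0.
rewrite /v /e; case: (leP 0 (1 - `|m i x - 1|)) => h; last by rewrite mul0r ler01.
have [h1|h1] := leP 1 (m i x).
  by rewrite ger0_norm ?subr_ge0//; nra.
by rewrite ltr0_norm ?subr_lt0//; nra.
Qed.

Let rt i x : t <= r i x.
Proof.
rewrite /r; have := EblkG1 i x; have : 0 <= 1 - t by rewrite subr_ge0.
set g := Eblk i G x => h1 h2; nra.
Qed.

(** All deficits have the same mean, which is what allows a single product to have every one of them
    as a marginal. *)
Let Er i : \int[P]_x r i x = M.
Proof.
rewrite /r EB ?Ecst ?EZ ?E_Eblk//; [exact: bm_Eblk|exact: bm_cst|].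
by apply: bmZ; exact: bm_Eblk.
Qed.

Let Mt : t <= M.
Proof.
have /card_gt0P[i _] := I0.
rewrite -(Er i) -[leLHS](Ecst P); apply: Ele => //; exact: bm_cst.
Qed.

Let M0 : 0 < M. Proof. exact: lt_le_trans Mt. Qed.

Let ErM i : \int[P]_x (r i x / M) = 1.
Proof.
under eq_E do rewrite mulrC.
by rewrite EZ// Er mulVf// gt_eqF.
Qed.

Let Eblk_a i x : Eblk i a x <= `|e i x| + n * t.
Proof.
rewrite (_ : a = fun x => `|e i x| + \sum_(j | j != i) `|e j x|); last first.
  by apply/funext => y; rewrite /a (bigD1 i).
have bs : bm (fun x => \sum_(j | j != i) `|e j x|).
  under eq_fun do rewrite -big_filter.
  exact: bm_sum.
rewrite EblkD// (Eblk_dep x (@dep_ae i)) lerD2l Eblk_indep; last first.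
  by apply: indep_sum.
under eq_E do rewrite -big_filter.
rewrite Esum// big_filter.
apply: (@le_trans _ _ (\sum_(j : I) t)).
  rewrite [leRHS](bigID (fun j => j != i))/= -[leLHS]addr0 lerD//.
    by apply: ler_sum => j _.
  by apply: sumr_ge0 => j _; exact: ltW.
by rewrite sumr_const -mulr_natl.
Qed.

(** Up to [t], the deficit is [1 - E_i G = - e i + E_i (f - G)], and [f - G = f (1 - w) <= A a]. In
    [E_i a] the term [|e i|] is frozen and each other term averages to at most [t]. *)
Let r_le i x : r i x <= (1 + A) * `|e i x| + (1 + A * n) * t.
Proof.
have h : 1 - Eblk i G x <= `|e i x| + A * Eblk i a x.
  have -> : 1 - Eblk i G x = - e i x + Eblk i (fun x => f x - G x) x.
    by rewrite EblkB// -/(m i x) /e; ring.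
  rewrite lerD//; first by rewrite -normrN ler_norm.
  rewrite -EblkZ//; apply: Eblk_le => [||y].
  - exact: bmB.
  - exact: bmZ.
  - rewrite /G -[X in X - _]mulr1 -mulrBr.
    apply: (@le_trans _ _ (f y * a y)); first by rewrite ler_wpM2l.
    by rewrite ler_wpM2r.
have h2 : A * Eblk i a x <= A * (`|e i x| + n * t) by rewrite ler_wpM2l.
have h3 := EblkG1 i x.
apply: (@le_trans _ _ (t + (1 - Eblk i G x))).
  have : 0 <= t * (1 - Eblk i G x) by rewrite mulr_ge0 ?subr_ge0// ltW.
  by rewrite /r mulrBr mulrBl; lra.
lra.
Qed.

Let Er2 i : \int[P]_x r i x ^+ 2 <= C1 * t ^+ 2.
Proof.
have be2 : bm (fun x => e i x ^+ 2) by exact: bmX.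
apply: (@le_trans _ _ (\int[P]_x (2 * (1 + A) ^+ 2 * e i x ^+ 2
   + 2 * (1 + A * n) ^+ 2 * t ^+ 2))).
  apply: Ele; first exact: bmX.
    by apply: bmD; [exact: bmZ|exact: bm_cst].
  move=> x; have h := r_le i x; have hr := le_trans (ltW t0) (rt i x).
  have h2 : r i x ^+ 2 <= ((1 + A) * `|e i x| + (1 + A * n) * t) ^+ 2.
    by rewrite lerXn2r// nnegrE (le_trans hr).
  apply: (le_trans h2); rewrite -(real_normK (num_real (e i x))).
  set p := (1 + A) * `|e i x|; set q := (1 + A * n) * t.
  have -> : 2 * (1 + A) ^+ 2 * `|e i x| ^+ 2 + 2 * (1 + A * n) ^+ 2 * t ^+ 2
    = 2 * p ^+ 2 + 2 * q ^+ 2 by rewrite /p /q; ring.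
  by have := sqr_ge0 (p - q); rewrite sqrrB sqrrD; lra.
rewrite ED; [|exact: bmZ|exact: bm_cst].
rewrite EZ// Ecst /C1 /corr_cst [leRHS]mulrDl lerD2r ler_wpM2l//.
by rewrite mulr_ge0// sqr_ge0.
Qed.

Let MC1 : M <= C1 * t.
Proof.
have /card_gt0P[i _] := I0; rewrite -(Er i).
apply: (le_trans (E_le_of_sq _ (Er2 i))) => //.
by rewrite ler_wpM2r ?(ltW t0)//; move: C1ge; lra.
Qed.

(* [G] has marginal densities at most 1, so the deficits [r i] of [(1 - t) G] are
   at least [t] and share the mass [M]; adding the normalized product [rho] of
   the deficits restores the marginals exactly. Deficits of size at least [t]
   with second moment of order [t ^ 2] make [rho] of order [t] in L2. *)
Lemma coupling_correction : exists al rho : T -> R,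
  [/\ bm al /\ bm rho, forall x, t <= al x <= 1, forall x, 0 < rho x,
      (forall i x, Eblk i (fun x => (1 - al x) * f x + rho x) x = 1) &
      [/\ \int[P]_x al x <= (1 + n) * t, \int[P]_x rho x <= C1 * t &
          \int[P]_x rho x ^+ 2 <= C1 ^+ (#|I| + 2) * t ^+ 2]].
Proof.
exists al, rho; split=> //.
- move=> x; rewrite /al; have /andP[h1 h2] := w01 x.
  have : 0 <= 1 - t by rewrite subr_ge0.
  move: h1 h2; set g := w x => h1 h2 h3; apply/andP; split; nra.
- move=> x; rewrite mulr_gt0// prodr_gt0// => i _.
  apply: divr_gt0; last exact: M0.
  exact: lt_le_trans t0 (rt i x).
- move=> i x.
  have -> : (fun x => (1 - al x) * f x + rho x) = (fun x => (1 - t) * G x + rho x).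
    by apply/funext => y; rewrite /al /G; ring.
  rewrite EblkD//; last exact: bmZ.
  rewrite EblkZ//.
  have -> : Eblk i rho x = r i x.
    rewrite EblkZ; last exact: bm_prod.
    rewrite Eblk_prod// big1 ?mulr1; last by move=> j _; exact: ErM.
    by rewrite mulrC divfK// gt_eqF.
  by rewrite /r; ring.
- split.
  + rewrite mulrDl mul1r; apply: (@le_trans _ _ (\int[P]_x (t + a x))).
      apply: Ele => //; first by apply: bmD => //; exact: bm_cst.
      move=> x; rewrite /al; have := w1a x; have /andP[h1 h2] := w01 x.
      move: h1 h2; set g := w x => h1 h2 h3; have := t0; nra.
    rewrite ED ?Ecst//; last exact: bm_cst.
    rewrite lerD2l Esum// (le_trans (ler_sum _ (fun i _ => Eae i)))//.
    by rewrite sumr_const -mulr_natl.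
  + rewrite EZ; last exact: bm_prod.
    by rewrite E_prod ?index_enum_uniq// big1 ?mulr1// => j _; exact: ErM.
  + under eq_E do rewrite /rho exprMn -prodrXl.
    have bk j : bm (fun x => (r j x / M) ^+ 2) by exact: bmX.
    rewrite EZ; last exact: bm_prod.
    rewrite E_prod ?index_enum_uniq//; last by move=> j x z; rewrite dep_r.
    (* Each factor has [E (r j)^2 <= C1 t^2 <= C1 M^2], since [t <= M]; then [M <= C1 t] supplies
       the two further powers of [C1] and the factor [t^2]. *)
    apply: (@le_trans _ _ (M ^+ 2 * C1 ^+ #|I|)).
      rewrite ler_wpM2l ?sqr_ge0// -prodr_const; apply: ler_prod => j _.
      apply/andP; split; first by apply: Rintegral_ge0 => x _; exact: sqr_ge0.
      under eq_E do rewrite exprMn mulrC.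
      rewrite EZ; last exact: bmX.
      rewrite exprVn mulrC ler_pdivrMr ?exprn_gt0//.
      apply: (le_trans (Er2 j)); rewrite ler_wpM2l ?(le_trans ler01)//.
      by rewrite lerXn2r// nnegrE ltW.
    rewrite exprD mulrC -mulrA; apply: ler_wpM2l.
      by rewrite exprn_ge0// (le_trans ler01).
    rewrite -exprMn; apply: lerXn2r => //; rewrite nnegrE; first exact: ltW.
    by apply: mulr_ge0; [exact: le_trans ler01 _|exact: ltW].
Qed.

End Correction.

End BlockExpectation.

Lemma ler_eta (R : realType) (a b c e0 : R) : 0 < e0 -> 0 <= c ->
  (forall e, 0 < e -> e <= e0 -> a <= b + e * c) -> a <= b.
Proof.
move=> e00 c0 h; apply/ler_addgt0Pr => e e_gt0.
pose e1 := Num.min e0 (e / (c + 1)).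
have c1 : 0 < c + 1 by rewrite ltr_wpDl.
have e1_gt0 : 0 < e1 by rewrite lt_min e00 divr_gt0.
apply: (le_trans (h e1 e1_gt0 _)); first by rewrite ge_min lexx.
rewrite lerD2l; apply: (@le_trans _ _ (e / (c + 1) * (c + 1))); last by rewrite divfK// gt_eqF.
apply: ler_pM => //; first exact: ltW.
  by rewrite ge_min lexx orbT.
by rewrite lerDl.
Qed.

(** * Convex conjugates: regularity of [psi] and growth of [phi] *)

Section Conjugates.
Context (R : realType) (phi psi : R -> R).
Hypothesis conj : conv_conjugates phi psi.
Hypothesis reg : dual_regular psi.
Let g := derive1 psi.

Lemma young x y : 0 <= x -> x * y - phi x <= psi y.
Proof.
move=> x0; have [_ _ _ _ /(_ y) psiE] := conj.
by rewrite -lee_fin psiE; apply: ereal_sup_ubound; exists x.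
Qed.

Lemma near_max y e : 0 < e -> exists x, 0 <= x /\ psi y - e <= x * y - phi x.
Proof.
move=> e0; have [_ _ _ _ /(_ y) psiE] := conj.
have : ((psi y - e)%:E < (psi y)%:E)%E by rewrite lte_fin ltrBlDr ltrDl.
rewrite psiE => /ereal_sup_gt[_ [x x0 <-]]; rewrite lte_fin => h.
by exists x; split => //; exact: ltW.
Qed.

Lemma phi_convex x y t : 0 <= x -> 0 <= y -> 0 <= t <= 1 ->
  phi (t * x + (1 - t) * y) <= t * phi x + (1 - t) * phi y.
Proof.
move=> x0 y0 /andP[]; rewrite le_eqVlt => /predU1P[<- _|t0].
  by rewrite !mul0r !subr0 !mul1r !add0r.
rewrite le_eqVlt => /predU1P[->|t1].
  by rewrite subrr !mul0r !mul1r !addr0.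
have [->|xy] := eqVneq x y.
  by rewrite -!mulrDl addrC subrK !mul1r.
have [sc _ _ _ _] := conj.
by apply: ltW; apply: sc => //; rewrite t0 t1.
Qed.

(* Differentiability of [psi] forces near-maximizers of the conjugate problem
   to converge to [psi' y], whether or not the supremum is attained. *)
Lemma near_maximizer y e : 0 < e -> exists x,
  [/\ 0 <= x, `|x - g y| <= e & psi y - e <= x * y - phi x].
Proof.
move=> e0; have [dpsi _ _ _] := reg.
have : (fun h => h^-1 *: (psi (h *: 1 + y) - psi y)) @ 0^' --> g y.
  by rewrite /g derive1E; exact: dpsi.
move/cvgrPdist_le => /(_ (e / 2)); rewrite divr_gt0// => /(_ isT).
move/nbhs_ballP => [r /= r0 hr].
pose dl := Num.min 1 (r / 2).
have dl0 : 0 < dl by rewrite lt_min ltr01 divr_gt0.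
have dl1 : dl <= 1 by rewrite ge_min lexx.
have dlr : dl < r.
  by rewrite gt_min; apply/orP; right; rewrite ltr_pdivrMr// ltr_pMr// ltr1n.
have hp : psi (y + dl) <= psi y + dl * g y + dl * (e / 2).
  have := hr dl; rewrite /ball/= sub0r normrN gtr0_norm// => /(_ dlr).
  rewrite gt_eqF// => /(_ isT); rewrite ler_norml => /andP[h _].
  rewrite /GRing.scale/= mulr1 (addrC dl) in h.
  have h2 : dl^-1 * (psi (y + dl) - psi y) <= g y + e / 2 by lra.
  rewrite mulrC ler_pdivrMr// in h2; lra.
have hm : psi (y - dl) <= psi y - dl * g y + dl * (e / 2).
  have := hr (- dl); rewrite /ball/= sub0r opprK gtr0_norm// => /(_ dlr).
  rewrite oppr_eq0 gt_eqF// => /(_ isT); rewrite ler_norml => /andP[_ h].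
  rewrite /GRing.scale/= mulr1 (addrC (- dl)) invrN mulNr in h.
  have h2 : g y - e / 2 <= dl^-1 * (psi y - psi (y - dl)).
    by move: h; rewrite !mulrBr; lra.
  rewrite [leRHS]mulrC ler_pdivlMr// in h2; lra.
(* The accuracy is proportional to [dl] because Young's inequality at [y + dl] and [y - dl] is
   divided by [dl] in the end; the slope error is then [e / 2] from here plus [e / 2] from the
   difference quotient. *)
have [|x [x0 hx]] := @near_max y (dl * (e / 2)).
  by rewrite mulr_gt0// divr_gt0.
have y1 := @young x (y + dl) x0; have y2 := @young x (y - dl) x0.
have de : dl * (e / 2) <= e.
  by apply: (@le_trans _ _ (1 * (e / 2))); [rewrite ler_wpM2r// ltW// divr_gt0|lra].
exists x; split => //; last by lra.
rewrite ler_norml; apply/andP; split; rewrite -(ler_pM2l dl0).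
  rewrite mulrBr in y2; lra.
rewrite mulrDr in y1; lra.
Qed.

(** A near-maximizer at [y] gives an affine minorant of [psi] that nearly touches at [y] and has
    slope close to [g y]; the error is then sent to 0. *)
Lemma psi_tangent y z : psi y + g y * (z - y) <= psi z.
Proof.
apply: (@ler_eta _ _ _ (1 + `|z - y|) 1) => // e e0 _.
have [x [x0 xg hx]] := near_maximizer y e0.
have := @young x z x0.
have : (g y - x) * (z - y) <= e * `|z - y|.
  by rewrite (le_trans (ler_norm _))// normrM ler_wpM2r// distrC.
lra.
Qed.

Lemma dpsi_ge0 y : 0 <= g y.
Proof.
apply: (@ler_eta _ _ _ 1 1) => // e e0 _.
have [x [x0 xg _]] := near_maximizer y e0.
by move: xg; rewrite ler_norml => /andP[]; lra.
Qed.

Lemma dpsi_nd : {homo g : x y / x <= y}.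
Proof.
move=> x y; rewrite le_eqVlt => /predU1P[->//|xy].
have h1 := psi_tangent x y; have h2 := psi_tangent y x.
have : (y - x) * (g y - g x) >= 0 by lra.
by rewrite pmulr_rge0 ?subr_gt0// subr_ge0.
Qed.

Lemma psi_nd : {homo psi : x y / x <= y}.
Proof.
move=> x y xy; apply: le_trans (psi_tangent x y).
by rewrite lerDl mulr_ge0// ?dpsi_ge0// subr_ge0.
Qed.

Lemma psi_continuous : continuous psi.
Proof.
move=> x; apply/differentiable_continuous/derivable1_diffP.
by have [+ _ _ _] := reg; exact.
Qed.

Lemma dpsi_continuous : continuous g.
Proof. by have [] := reg. Qed.

Lemma dpsi_eq1 : exists x0, g x0 = 1.
Proof. by have [_ _ _ [x0 [dl [_ _ h _]]]] := reg; exists x0. Qed.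

Lemma dpsi_gt1 : exists x0, 1 < g x0.
Proof.
have [_ _ [C [C0 h]] _] := reg; exists (C + 2).
by apply: lt_le_trans (h _ _); lra.
Qed.

(** Since [psi'(z) >= z] for large [z], the value [x + 1] is taken by [g] at some [y] bounded
    linearly in [x]. A near-maximizer at [y] lies in [[x, x + 2]], where [phi] is at most about
    [(x + 2) y]; convexity between 0 and that point bounds [phi x]. *)
Lemma phi_quadratic : exists K, 0 <= K /\ forall x, 0 <= x -> phi x <= K * (1 + x ^+ 2).
Proof.
have [_ _ [C [C0 hC]] [x0 [dl [x00 _ gx0 _]]]] := reg.
exists (2 * `|phi 0| + 4 + 3 * (C + 1 + x0)); split.
  by have := normr_ge0 (phi 0); lra.
move=> x xge0; pose Y := C + x + 1 + x0.
have gY : x + 1 <= g Y by apply: le_trans (hC _ _); rewrite /Y; lra.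
have x0Y : x0 <= Y by rewrite /Y; lra.
have [y] : exists2 y, y \in `[x0, Y] & g y = x + 1.
  apply: IVT => //; first by apply: continuous_subspaceT; exact: dpsi_continuous.
  have gx0' : g x0 = 1 := gx0.
  have h1 : 1 <= g Y by lra.
  by rewrite gx0' (min_l h1) (max_r h1); apply/andP; split; lra.
rewrite in_itv/= => /andP[y0 yY] gy.
have [x2 [x20]] := near_maximizer y (@ltr01 R).
rewrite gy ler_norml => /andP[h1 h2] h3.
have p0 : - phi 0 <= psi y by have := @young 0 y (lexx _); lra.
have x2y : x2 * y <= (x + 2) * Y by apply: ler_pM => //; lra.
have a0 := ler_norm (phi 0).
have px2 : phi x2 <= (x + 2) * Y + 1 + `|phi 0| by lra.
have px : phi x <= (x + 2) * Y + 1 + 2 * `|phi 0|.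
  have XY : 0 <= (x + 2) * Y by apply: mulr_ge0; lra.
  have [xe0|xn0] := eqVneq x 0.
    by have px0 : phi x = phi 0 by [rewrite xe0]; have := normr_ge0 (phi 0); lra.
  have x2gt0 : 0 < x2 by apply: lt_le_trans (_ : x <= x2); [rewrite lt_neqAle eq_sym xn0|lra].
  have t01 : 0 <= x / x2 <= 1.
    by rewrite divr_ge0//= ler_pdivrMr// mul1r; lra.
  have := phi_convex x20 (lexx 0) t01.
  rewrite mulr0 addr0 divfK ?gt_eqF//.
  move: t01; set t := x / x2 => /andP[t0 t1] h.
  have hh : t * phi x2 <= t * ((x + 2) * Y + 1 + `|phi 0|) by rewrite ler_wpM2l.
  have h4 : (1 - t) * phi 0 <= (1 - t) * `|phi 0| by rewrite ler_wpM2l// subr_ge0.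
  have h5 : t * ((x + 2) * Y + 1) <= 1 * ((x + 2) * Y + 1) by rewrite ler_wpM2r//; lra.
  have h6 := normr_ge0 (phi 0); lra.
apply: (le_trans px); rewrite /Y; have := normr_ge0 (phi 0).
set q := `|phi 0| => q0; have := sqr_ge0 (x - 1); have := sqr_ge0 x.
have : 0 <= C + 1 + x0 by lra.
have -> : C + x + 1 + x0 = x + (C + 1 + x0) by ring.
set D := C + 1 + x0 => D0 hx hx1.
have : 0 <= D * (x - 1) ^+ 2 by exact: mulr_ge0.
have : 0 <= D * x ^+ 2 by exact: mulr_ge0.
have : 0 <= q * x ^+ 2 by exact: mulr_ge0.
rewrite expr2 in hx hx1 *.
rewrite !expr2; nra.
Qed.

(* The right-hand value [y * psi' y - psi y] may be smaller than
   [phi (psi' y)] when [psi' y = 0], as [phi] need not be lower semicontinuous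
   at 0; mixing with a positive point repairs this. *)
Lemma phi_mix K y al v : 0 <= K -> (forall x, 0 <= x -> phi x <= K * (1 + x ^+ 2)) ->
  0 < al <= 1 -> 0 < v ->
  phi ((1 - al) * g y + al * v) <= (1 - al) * (y * g y - psi y) + al * K * (1 + v ^+ 2).
Proof.
move=> K0 Kphi /andP[al0 al1] v0.
have aln0 : al != 0 by rewrite gt_eqF.
have ial0 : 0 < al^-1 by rewrite invr_gt0.
apply: (@ler_eta _ _ _ ((`|y| + 1) + K * (2 * v + al^-1)) (Num.min 1 (al * v))).
- by rewrite lt_min ltr01 mulr_gt0.
- by rewrite addr_ge0// ?mulr_ge0 ?addr_ge0// ?mulr_ge0// ltW.
move=> e e0; rewrite le_min => /andP[e1 eav].
have [x [x0 xg hx]] := near_maximizer y e0.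
(* [u] moves the gap between [g y] and the near-maximizer [x] into the second point of the convex
   combination; [e <= al * v] keeps [v + u] nonnegative. *)
pose u := al^-1 * ((1 - al) * (g y - x)).
have ule : `|u| <= al^-1 * e.
  rewrite /u normrM gtr0_norm// ler_wpM2l ?(ltW ial0)// normrM.
  rewrite -[leRHS]mul1r ler_pM//; last by rewrite distrC.
  by rewrite ger0_norm ?subr_ge0//; lra.
have ev : al^-1 * e <= v by rewrite mulrC ler_pdivrMr// mulrC.
have vu0 : 0 <= v + u by move: ule; rewrite ler_norml => /andP[]; lra.
have -> : (1 - al) * g y + al * v = (1 - al) * x + (1 - (1 - al)) * (v + u).
  by rewrite /u; field.
apply: le_trans (phi_convex x0 vu0 _) _; first by rewrite subr_ge0 al1/= gerBl ltW.
have h1 := Kphi _ vu0.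
have h2 : phi x <= x * y - psi y + e by lra.
have -> : 1 - (1 - al) = al by ring.
have h3 : (1 - al) * phi x <= (1 - al) * (x * y - psi y + e).
  by rewrite ler_wpM2l// subr_ge0.
have h4 : al * phi (v + u) <= al * (K * (1 + (v + u) ^+ 2)) by rewrite ler_wpM2l// ltW.
have h5 : (1 - al) * ((x - g y) * y) <= e * `|y|.
  apply: (@le_trans _ _ (1 * (e * `|y|))); last by rewrite mul1r.
  apply: le_trans (ler_norm _) _; rewrite normrM ler_pM//.
    by rewrite ger0_norm ?subr_ge0//; lra.
  by rewrite normrM ler_wpM2r.
have h6 : (1 - al) * e <= e by rewrite ler_piMl// ?(ltW e0)//; lra.
have h7 : al * (2 * v * u + u ^+ 2) <= e * (2 * v + al^-1).
  have uu : u ^+ 2 <= (al^-1 * e) ^+ 2.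
    by rewrite -(real_normK (num_real u)) lerXn2r// nnegrE ?mulr_ge0// ltW.
  have u1 : 2 * v * u <= 2 * v * (al^-1 * e).
    by rewrite ler_wpM2l ?mulr_ge0 ?(ltW v0)// (le_trans (ler_norm _)).
  apply: (@le_trans _ _ (al * (2 * v * (al^-1 * e) + (al^-1 * e) ^+ 2))).
    by rewrite ler_wpM2l ?(ltW al0)// lerD.
  have -> : al * (2 * v * (al^-1 * e) + (al^-1 * e) ^+ 2) = e * (2 * v + al^-1 * e).
    by field.
  by rewrite ler_wpM2l ?(ltW e0)// lerD2l ler_piMr// ltW.
have h8 : K * (al * (2 * v * u + u ^+ 2)) <= K * (e * (2 * v + al^-1)) by rewrite ler_wpM2l.
rewrite sqrrD in h4.
move: h4; have -> : al * (K * (1 + (v ^+ 2 + v * u *+ 2 + u ^+ 2))) =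
  al * K * (1 + v ^+ 2) + K * (al * (2 * v * u + u ^+ 2)) by ring.
move: h3; have -> : (1 - al) * (x * y - psi y + e) =
  (1 - al) * (y * g y - psi y) + (1 - al) * ((x - g y) * y) + (1 - al) * e by ring.
have -> : e * (`|y| + 1 + K * (2 * v + al^-1)) =
  e * `|y| + e + K * (e * (2 * v + al^-1)) by ring.
lra.
Qed.

(** For [s = 1] the bound is the Lipschitz clause of [Cs1]; for larger [s] it is the mean value
    theorem with the maximum of [|psi''|] on [[-B, B]]. [1 <= L] is arranged so that the gradient
    step [1 / (2 L)] is at most 1. *)
Lemma dpsi_locally_lipschitz s B : (0 < s)%N -> Cs1 s psi ->
  exists L, 1 <= L /\ forall x y, `|x| <= B -> `|y| <= B -> `|g x - g y| <= L * `|x - y|.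
Proof.
case: s => // -[|s] _ [ds cs [L hL]].
  exists (Num.max 1 L); split; first by rewrite le_max lexx.
  move=> x y _ _; apply: le_trans (hL x y) _.
  by rewrite ler_wpM2r// le_max lexx orbT.
have dg x : derivable g x 1 by exact: (ds 1%N).
have cg : continuous (derive1 g) by exact: (cs 2%N).
have [B0|B0] := ltP B 0.
  exists 1; split => // x y xB; have := normr_ge0 x; lra.
have BB : - B <= B by lra.
have [c _ cmax] := @EVT_max _ (fun x => `|derive1 g x|) _ _ BB
  (continuous_subspaceT (fun x => continuous_comp (cg x) (@norm_continuous _ _ _))).
exists (Num.max 1 `|derive1 g c|); split; first by rewrite le_max lexx.
have key x y : x < y -> `|x| <= B -> `|y| <= B ->
    `|g x - g y| <= Num.max 1 `|derive1 g c| * `|x - y|.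
  move=> xy xB yB.
  have dgz z : z \in `]x, y[ -> is_derive z 1 g (derive1 g z).
    by move=> _; rewrite derive1E; exact: derivableP.
  have cgxy : {within `[x, y], continuous g}.
    by apply: continuous_subspaceT; exact: dpsi_continuous.
  have [z zxy gz] := MVT xy dgz cgxy.
  rewrite distrC gz normrM (distrC x) ler_wpM2r// le_max; apply/orP; right.
  apply: cmax; move: zxy xB yB; rewrite !in_itv/= !ler_norml => /andP[? ?] /andP[? ?] /andP[? ?].
  by apply/andP; split; lra.
move=> x y xB yB; have [xy|yx|->] := ltgtP x y.
- exact: key.
- by rewrite distrC (distrC x); exact: key.
- by rewrite !subrr normr0 mulr0.
Qed.

(** The tangent inequality at the clipped argument. Replacing the cost by [- c0] or [c0] in the
    slopes leaves them depending on [H] only, so they will factor from the clipped block under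
    expectation. *)
Lemma clip_gain lo hi c0 u H cx : `|cx| <= c0 -> lo <= hi ->
  Num.max 0 (lo - u) * (1 - g (lo + H + c0))
    + Num.max 0 (u - hi) * (g (hi + H - c0) - 1)
  <= (Num.max lo (Num.min hi u) + H - psi (Num.max lo (Num.min hi u) + H - cx))
     - (u + H - psi (u + H - cx)).
Proof.
move=> cxc0 lohi; set k := Num.max lo (Num.min hi u).
have /ler_normlP[cx1 cx2] := cxc0.
have [ulo|ulo] := ltP u lo.
  have -> : k = lo by rewrite /k min_r ?max_l//; lra.
  rewrite (max_r (_ : 0 <= lo - u)) ?max_l; [|lra|lra].
  have t := psi_tangent (lo + H - cx) (u + H - cx).
  have gg : g (lo + H - cx) * (lo - u) <= g (lo + H + c0) * (lo - u).
    by rewrite ler_wpM2r ?dpsi_nd//; lra.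
  have e1 : g (lo + H - cx) * (u + H - cx - (lo + H - cx)) =
    - (g (lo + H - cx) * (lo - u)) by ring.
  have -> : (lo - u) * (1 - g (lo + H + c0)) + 0 * (g (hi + H - c0) - 1) =
    lo - u - g (lo + H + c0) * (lo - u) by ring.
  by lra.
have [uhi|uhi] := ltP hi u.
  have -> : k = hi by rewrite /k min_l ?max_r//; lra.
  rewrite (max_l (_ : lo - u <= 0)) ?max_r; [|lra|lra].
  have t := psi_tangent (hi + H - cx) (u + H - cx).
  have gg : g (hi + H - c0) * (u - hi) <= g (hi + H - cx) * (u - hi).
    by rewrite ler_wpM2r ?dpsi_nd//; lra.
  have e1 : g (hi + H - cx) * (u + H - cx - (hi + H - cx)) =
    g (hi + H - cx) * (u - hi) by ring.
  have -> : 0 * (1 - g (lo + H + c0)) + (u - hi) * (g (hi + H - c0) - 1) =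
    g (hi + H - c0) * (u - hi) - (u - hi) by ring.
  by lra.
have -> : k = u by rewrite /k min_r ?max_r//; lra.
rewrite (max_l (_ : lo - u <= 0)) ?max_l; [|lra|lra].
by rewrite !mul0r addr0 subrr.
Qed.

End Conjugates.

(** * The dual functional: primal competitors, truncation and near-optimality *)

Section DualFunctional.
Context d (T : measurableType d) (R : realType) (I : finType).
Variable mix : I -> T -> T -> T.
Hypothesis mmix : forall i, measurable_fun setT (fun p : T * T => mix i p.1 p.2).
Hypothesis mixl : forall i x z u, mix i (mix i x z) u = mix i x u.
Hypothesis mixr : forall i j x z u, i != j -> mix j (mix i x z) u = mix j z u.
Variables (phi psi : R -> R).
Hypothesis conj : conv_conjugates phi psi.
Hypothesis reg : dual_regular psi.
Variables (c : T -> R) (c0 : R).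
Hypotheses (bc : bm c) (cc0 : forall x, `|c x| <= c0).
Hypothesis I0 : (0 < #|I|)%N.
Let g := derive1 psi.
Let n : R := #|I|%:R.

Definition pot (h : I -> T -> R) (x : T) := \sum_i h i x - c x.
Definition dual_integrand (h : I -> T -> R) (x : T) :=
  \sum_i h i x - psi (pot h x).
Definition dual (P : probability T R) (h : I -> T -> R) : R :=
  \int[P]_x dual_integrand h x.
Definition potentials (h : I -> T -> R) := forall i, bm (h i) /\ dep mix i (h i).

Let bm_h h i : potentials h -> bm (h i). Proof. by move=> /(_ i)[]. Qed.
Let dep_h h i : potentials h -> dep mix i (h i). Proof. by move=> /(_ i)[]. Qed.

Let c00 : 0 <= c0. Proof. exact: le_trans (cc0 point). Qed.
Let n0 : 0 <= n. Proof. exact: ler0n. Qed.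

Let bm_psi k : bm k -> bm (fun x : T => psi (k x)).
Proof. by apply: bm_comp; [exact: psi_continuous reg|exact: psi_nd conj reg]. Qed.

Let bm_g k : bm k -> bm (fun x : T => g (k x)).
Proof. by apply: bm_comp; [exact: dpsi_continuous reg|exact: dpsi_nd conj reg]. Qed.

Let g0 y : 0 <= g y. Proof. exact: (dpsi_ge0 conj reg). Qed.
Let g_nd : {homo g : x y / x <= y}. Proof. exact: (dpsi_nd conj reg). Qed.

Lemma bm_pot h : potentials h -> bm (pot h).
Proof. by move=> ph; apply: bmB => //; apply: bm_sum => i; exact: bm_h. Qed.

Lemma bm_dual_integrand h : potentials h -> bm (dual_integrand h).
Proof.
move=> ph; apply: bmB; first by apply: bm_sum => i; exact: bm_h.
by apply: bm_psi; exact: bm_pot.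
Qed.

Lemma pot_bound h B x : (forall i x, `|h i x| <= B) -> `|pot h x| <= n * B + c0.
Proof.
move=> hB; apply: (le_trans (ler_normB _ _)); rewrite lerD//.
apply: (le_trans (ler_norm_sum _ _ _)).
by apply: (le_trans (ler_sum _ (fun i _ => hB i x))); rewrite sumr_const -mulr_natl.
Qed.

(** Young's inequality at [x = 1], where [phi] vanishes, gives [pot <= psi (pot)], so the integrand
    is at most [c]. *)
Lemma dual_le P h : potentials h -> dual P h <= c0.
Proof.
move=> ph; rewrite -[leRHS](Ecst P); apply: Ele.
- exact: bm_dual_integrand.
- exact: bm_cst.
move=> x; have := young conj (pot h x) ler01; have [_ _ -> _ _] := conj.
rewrite mul1r subr0 /dual_integrand /pot; have := ler_norm (c x); have := cc0 x; lra.
Qed.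

Lemma dual_ge P h B : potentials h -> (forall i x, `|h i x| <= B) ->
  - (n * B + `|psi (n * B + c0)|) <= dual P h.
Proof.
move=> ph hB; rewrite -[leLHS](Ecst P); apply: Ele.
- exact: bm_cst.
- exact: bm_dual_integrand.
move=> x; rewrite /dual_integrand.
have h1 : psi (pot h x) <= psi (n * B + c0).
  by apply: (psi_nd conj reg); rewrite (le_trans (ler_norm _))// pot_bound.
have h2 := ler_norm (psi (n * B + c0)).
have : `|\sum_i h i x| <= n * B.
  apply: (le_trans (ler_norm_sum _ _ _)).
  by apply: (le_trans (ler_sum _ (fun i _ => hB i x))); rewrite sumr_const -mulr_natl.
rewrite ler_norml => /andP[]; lra.
Qed.

Section Measure.
Variable P : probability T R.
Hypothesis mixP : forall i A, measurable A ->
  P A = (P \x P)%E ((fun p => mix i p.1 p.2) @^-1` A).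

(** The error of the [i]-th marginal density of [psi'(pot)]; its negative is also the gradient of
    the dual value in [h i]. *)
Definition defect (h : I -> T -> R) i x := Eblk mix P i (fun x => g (pot h x)) x - 1.

Lemma bm_defect h i : potentials h -> bm (defect h i).
Proof.
move=> ph; apply: bmB; last exact: bm_cst.
by apply: bm_Eblk => //; apply: bm_g; exact: bm_pot.
Qed.

Section Primal.
Variables (K B : R).
Hypotheses (K0 : 0 <= K) (Kphi : forall x, 0 <= x -> phi x <= K * (1 + x ^+ 2)).

Let A := g (n * B + c0).
Let B2 := (n * B + c0) * A + `|psi (n * B + c0)| + `|psi (- (n * B + c0))|.

(** In order: the pairing of potentials with defects, the change of transport cost, the terms linear
    in the weight [al], and the quadratic price of [rho]. *)
Definition primal_cst : R :=
  B * n + c0 * (A * (1 + n) + corr_cst I A) + (B2 + K) * (1 + n)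
  + K * corr_cst I A ^+ (#|I| + 2).

(** Before correction, equality in Young's inequality would make the primal integrand
    [s f - psi (y)] with [s = sum_i h i], whose mean differs from the dual value by the sum of
    [E (h i * defect h i)]. [G] is a bounded measurable majorant that can be integrated in place of
    the corrected integrand. *)
Lemma primal_competitor h t : potentials h -> (forall i x, `|h i x| <= B) ->
  0 < t <= 1 -> (forall i, \int[P]_x defect h i x ^+ 2 <= t ^+ 2) ->
  exists fh G : T -> R, [/\ bm fh, bm G, forall x, 0 <= fh x,
    forall i x, Eblk mix P i fh x = 1 &
    (forall x, c x * fh x + phi (fh x) <= G x) /\
    \int[P]_x G x <= dual P h + primal_cst * t].
Proof.
move=> ph hB /andP[t0 t1] ht; pose f x := g (pot h x); pose y := pot h.
have bpot := bm_pot ph.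
have bf : bm f by exact: bm_g.
have yle x : `|y x| <= n * B + c0 by exact: pot_bound.
have f0 x : 0 <= f x by exact: g0.
have fA x : f x <= A by apply: g_nd; rewrite (le_trans (ler_norm _))// pot_bound.
have [al [rho [[bal brho] al01 rho0 m1 [Eal Erho Erho2]]]] :=
  coupling_correction mmix mixl mixr mixP bf f0 fA t0 t1 I0 ht.
have A0 : 0 <= A by exact: g0.
have B20 : 0 <= B2.
  by rewrite /B2 !addr_ge0// mulr_ge0// (le_trans _ (yle point)).
pose v x := y x * f x - psi (y x).
have bv : bm v by apply: bmB; [exact: bmM|exact: bm_psi].
have vB x : `|v x| <= B2.
  apply: (le_trans (ler_normB _ _)); rewrite /B2 -[leRHS]addrA lerD//.
    by rewrite normrM (ger0_norm (f0 x)) ler_pM.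
  have /ler_normlP[h1 h2] := yle x.
  have p1 : psi (y x) <= psi (n * B + c0) by exact: (psi_nd conj reg).
  have p2 : psi (- (n * B + c0)) <= psi (y x) by apply: (psi_nd conj reg); lra.
  rewrite ler_norml; have := ler_norm (psi (n * B + c0)).
  have := ler_norm (- psi (- (n * B + c0))); rewrite normrN.
  have := normr_ge0 (psi (n * B + c0)); have := normr_ge0 (psi (- (n * B + c0))).
  by move=> ? ? ? ?; apply/andP; split; lra.
pose s x := \sum_i h i x.
have bs : bm s by apply: bm_sum => i; exact: bm_h.
pose G1 x := s x * f x - psi (y x).
have bG1 : bm G1 by apply: bmB; [exact: bmM|exact: bm_psi].
pose G x := G1 x + ((c0 * A + B2 + K) * al x + (c0 * rho x + K / t * rho x ^+ 2)).
have brho2 : bm (fun x => K / t * rho x ^+ 2) by apply: bmZ; exact: bmX.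
have bG2 : bm (fun x => c0 * rho x + K / t * rho x ^+ 2) by apply: bmD => //; exact: bmZ.
have bG3 : bm (fun x => (c0 * A + B2 + K) * al x) by exact: bmZ.
have bG : bm G by apply: bmD => //; exact: bmD.
exists (fun x => (1 - al x) * f x + rho x), G; split => //.
- by apply: bmD => //; apply: bmM => //; apply: bmB => //; exact: bm_cst.
- move=> x; have /andP[a0 a1] := al01 x.
  by rewrite addr_ge0// ?(ltW (rho0 x))// mulr_ge0// subr_ge0.
split.
  move=> x; have /andP[a0 a1] := al01 x; have al0 : 0 < al x by exact: lt_le_trans a0.
  have h1 : phi ((1 - al x) * f x + rho x) <=
      v x + al x * B2 + K * al x + K / t * rho x ^+ 2.
    (* Reading [rho] as [al] times [rho / al] makes the competitor a convex combination as in
       [phi_mix]; the price [K rho^2 / al] is at most [K rho^2 / t]. *)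
    have rr : al x * (rho x / al x) = rho x by rewrite mulrC divfK// gt_eqF.
    have h0 : phi ((1 - al x) * f x + al x * (rho x / al x)) <=
        (1 - al x) * v x + al x * K * (1 + (rho x / al x) ^+ 2).
      apply: phi_mix => //; first by rewrite al0 a1.
      by rewrite divr_gt0.
    rewrite rr in h0.
    have h2 : (1 - al x) * v x <= v x + al x * B2.
      have := vB x; rewrite ler_norml => /andP[h2 _].
      have : al x * (- B2) <= al x * v x by rewrite ler_wpM2l// ltW.
      by rewrite mulrBl mul1r mulrN; lra.
    have h3 : al x * K * (1 + (rho x / al x) ^+ 2) =
        K * al x + K * (rho x ^+ 2 / al x) by field; rewrite gt_eqF.
    have : K * (rho x ^+ 2 / al x) <= K / t * rho x ^+ 2.
      rewrite -mulrA ler_wpM2l// (mulrC t^-1) ler_wpM2l ?sqr_ge0//.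
      by rewrite lef_pV2// posrE.
    by lra.
  have h2 : c x * ((1 - al x) * f x + rho x) <= c x * f x + c0 * A * al x + c0 * rho x.
    have -> : c x * ((1 - al x) * f x + rho x) =
      c x * f x + (- c x * (al x * f x) + c x * rho x) by ring.
    rewrite -addrA lerD2l lerD//.
      rewrite -mulrA; apply: (@le_trans _ _ (c0 * (al x * f x))).
        rewrite ler_wpM2r ?mulr_ge0 ?(ltW al0)//.
        by rewrite (le_trans (ler_norm _))// normrN.
      by rewrite ler_wpM2l// mulrC ler_wpM2r// ltW.
    by rewrite ler_wpM2r ?(ltW (rho0 x))// (le_trans (ler_norm _)).
  rewrite /G /G1 /s; move: h1 h2; rewrite /v /y /pot.
  set S := \sum_i h i x; lra.
have bhf i : bm (fun x => h i x * f x) by apply: bmM => //; exact: bm_h.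
have EG1 : \int[P]_x G1 x <= dual P h + B * n * t.
  have -> : \int[P]_x G1 x = dual P h + \sum_i \int[P]_x (h i x * defect h i x).
    have bhd i : bm (fun x => h i x * defect h i x).
      by apply: bmM; [exact: bm_h|exact: bm_defect].
    have bpsi : bm (fun x => psi (y x)) by exact: bm_psi.
    have Esf : \int[P]_x (s x * f x) = \sum_i \int[P]_x (h i x * f x).
      by rewrite -Esum//; apply: eq_E => x; rewrite /s mulr_suml.
    have Es : \int[P]_x s x = \sum_i \int[P]_x h i x.
      by rewrite -Esum// => i; exact: bm_h.
    have -> : dual P h = \int[P]_x s x - \int[P]_x psi (y x) by rewrite -EB.
    rewrite EB ?Esf ?Es//; last exact: bmM.
    rewrite addrAC -big_split/=; congr (_ - _); apply: eq_bigr => i _.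
    rewrite (E_depM mmix mixP (bm_h i ph) bf (dep_h i ph)) -ED//; last exact: bm_h.
    by apply: eq_E => x; rewrite /defect; ring.
  rewrite lerD2l.
  have -> : B * n * t = \sum_(i : I) B * t by rewrite sumr_const -mulr_natl -/n; ring.
  apply: ler_sum => i _.
  have bd : bm (fun x => `|defect h i x|) by apply: bm_abs; exact: bm_defect.
  have B0 : 0 <= B by rewrite (le_trans _ (hB i point)).
  apply: (@le_trans _ _ (\int[P]_x (B * `|defect h i x|))).
    apply: Ele; [by apply: bmM; [exact: bm_h|exact: bm_defect]|exact: bmZ|].
    by move=> x; rewrite (le_trans (ler_norm _))// normrM ler_wpM2r.
  rewrite EZ// ler_wpM2l//.
  have -> : t = (1 + 1) / 2 * t :> R by field.
  apply: E_le_of_sq => //; rewrite mul1r.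
  by under eq_E do rewrite -normrX ger0_norm ?sqr_ge0//.
have brho2' : bm (fun x => rho x ^+ 2) by exact: bmX.
have -> : \int[P]_x G x = \int[P]_x G1 x + ((c0 * A + B2 + K) * \int[P]_x al x +
    (c0 * \int[P]_x rho x + K / t * \int[P]_x rho x ^+ 2)).
  rewrite -(EZ P _ bal) -(EZ P _ brho) -(EZ P _ brho2').
  rewrite -(ED P (bmZ c0 brho) brho2) -(ED P bG3 bG2) -(ED P bG1)//.
  exact: bmD.
have e1 : (c0 * A + B2 + K) * \int[P]_x al x <= (c0 * A + B2 + K) * ((1 + n) * t).
  apply: ler_wpM2l => //; apply: addr_ge0 => //; apply: addr_ge0 => //.
  exact: mulr_ge0.
have e2 : c0 * \int[P]_x rho x <= c0 * (corr_cst I A * t) by rewrite ler_wpM2l.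
have e3 : K / t * \int[P]_x rho x ^+ 2 <= K * corr_cst I A ^+ (#|I| + 2) * t.
  apply: (@le_trans _ _ (K / t * (corr_cst I A ^+ (#|I| + 2) * t ^+ 2))).
    by rewrite ler_wpM2l// divr_ge0// ltW.
  by rewrite le_eqVlt; apply/orP; left; apply/eqP; field; rewrite gt_eqF.
apply: (le_trans (lerD EG1 (lerD e1 (lerD e2 e3)))).
rewrite /primal_cst le_eqVlt; apply/orP; left; apply/eqP; ring.
Qed.

End Primal.

Definition upd (h : I -> T -> R) i k := fun j => if j == i then k else h j.

Let sum_upd h i k x : \sum_j upd h i k j x = k x + \sum_(j | j != i) h j x.
Proof.
rewrite (bigD1 i)//= /upd eqxx; congr (_ + _).
by apply: eq_bigr => j /negbTE ->.
Qed.

Let sum_D1 (h : I -> T -> R) i x : \sum_j h j x = h i x + \sum_(j | j != i) h j x.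
Proof. by rewrite (bigD1 i). Qed.

Lemma potentials_upd h i k : potentials h -> bm k -> dep mix i k ->
  potentials (upd h i k).
Proof. by move=> ph bk dk j; rewrite /upd; case: eqP => [->|]. Qed.

(** [a] is the supremum of the levels where the mean of [g] is at most 1. The margins of 1 on both
    sides make monotonicity of that mean sufficient. *)
Lemma exists_level (H : T -> R) (M x0 x1 : R) : bm H -> (forall x, `|H x| <= M) ->
  g x0 = 1 -> 1 < g x1 ->
  exists a, [/\ x0 - c0 - M <= a, a <= x1 - c0 + M,
    \int[P]_x g (a - 1 + H x + c0) <= 1 & 1 <= \int[P]_x g (a + 1 + H x + c0)].
Proof.
move=> bH HM gx0 gx1.
pose th u := \int[P]_x g (u + H x + c0).
have bmth u : bm (fun x => g (u + H x + c0)).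
  by apply: bm_g; apply: bmD; [apply: bmD => //; exact: bm_cst|exact: bm_cst].
have th_nd u v : u <= v -> th u <= th v.
  by move=> uv; apply: Ele => // x; apply: g_nd; rewrite lerD2r lerD2r.
pose S := [set u | th u <= 1].
have Sx0 : S (x0 - c0 - M).
  rewrite /S/= -(Ecst P 1); apply: Ele => //; first exact: bm_cst.
  by move=> x; rewrite -gx0; apply: g_nd; have /ler_normlP[] := HM x; lra.
have Sub u : S u -> u <= x1 - c0 + M.
  move=> Su; rewrite leNgt; apply/negP => h.
  suff : g x1 <= th u by move: Su; rewrite /S/=; lra.
  rewrite -[leLHS](Ecst P); apply: Ele => //; first exact: bm_cst.
  by move=> x; apply: g_nd; have /ler_normlP[] := HM x; lra.
have Ssup : has_sup S by split; [exists (x0 - c0 - M)|exists (x1 - c0 + M)].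
exists (sup S); split.
- exact: ub_le_sup Ssup.2 _ Sx0.
- by apply: ge_sup Ssup.1 _ => u; exact: Sub.
- have [u Su hu] := sup_adherent (@ltr01 R) Ssup.
  by apply: le_trans Su; apply: th_nd; exact: ltW.
- rewrite leNgt; apply/negP => /ltW h.
  by have : sup S + 1 <= sup S by [apply: ub_le_sup Ssup.2 _ _]; lra.
Qed.

(** [2 c0] absorbs the oscillation of the cost, and 2 the two margins of [exists_level]. *)
Let wd := 2 * c0 + 2.

Let wd0 : 0 <= wd. Proof. by rewrite /wd; have := c00; lra. Qed.

(* Truncating one potential to an interval of length [wd] increases the dual
   value: below (above) the interval the conditional mass
   [E_i psi'(pot)] is at most (at least) 1. *)
Lemma dual_clip h i M x0 x1 : potentials h -> g x0 = 1 -> 1 < g x1 ->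
  (forall x, `|\sum_(j | j != i) h j x| <= M) ->
  exists lo, [/\ x0 - c0 - M - 1 <= lo, lo <= x1 - c0 + M - 1 &
    dual P h <= dual P (upd h i (fun x => Num.max lo (Num.min (lo + wd) (h i x))))].
Proof.
move=> ph gx0 gx1; pose H x := \sum_(j | j != i) h j x => HM.
have bH : bm H.
  by rewrite /H; under eq_fun do rewrite -big_filter; apply: bm_sum => j; exact: bm_h.
have iH : indep mix i H by apply: indep_sum => // j; exact: dep_h.
have [a [a1 a2 tha thb]] := exists_level bH HM gx0 gx1.
exists (a - 1); split; [by rewrite lerD2r|by rewrite lerD2r|].
set lo := a - 1; set hi := lo + wd; set k := fun x => Num.max lo _.
have bhi := bm_h i ph; have dhi := dep_h i ph.
have bk : bm k by apply: bm_max; [exact: bm_cst|apply: bm_min => //; exact: bm_cst].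
have dk : dep mix i k by move=> x z; rewrite /k dhi.
have pu := potentials_upd ph bk dk.
pose p x := Num.max 0 (lo - h i x); pose q x := Num.max 0 (h i x - hi).
have bp : bm p by apply: bm_max; [exact: bm_cst|apply: bmB => //; exact: bm_cst].
have bq : bm q by apply: bm_max; [exact: bm_cst|apply: bmB => //; exact: bm_cst].
have dp : dep mix i p by move=> x z; rewrite /p dhi.
have dq : dep mix i q by move=> x z; rewrite /q dhi.
pose g1 x := 1 - g (lo + H x + c0); pose g2 x := g (hi + H x - c0) - 1.
have bgl u r : bm (fun x => g (u + H x + r)).
  by apply: bm_g; apply: bmD; [apply: bmD => //; exact: bm_cst|exact: bm_cst].
have bg1 : bm g1 by apply: bmB => //; exact: bm_cst.
have bg2 : bm g2 by apply: bmB => //; exact: bm_cst.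
have i1 : indep mix i g1 by move=> x z; rewrite /g1 iH.
have i2 : indep mix i g2 by move=> x z; rewrite /g2 iH.
(* [p] and [q] depend on block [i] only, [g1] and [g2] on the other blocks only, so each expectation
   splits into two nonnegative factors. *)
have key : 0 <= \int[P]_x (p x * g1 x + q x * g2 x).
  rewrite ED; [|exact: bmM..].
  rewrite (E_indepM mmix mixP bp bg1 dp i1) (E_indepM mmix mixP bq bg2 dq i2).
  have -> : \int[P]_x g1 x = 1 - \int[P]_x g (lo + H x + c0).
    by rewrite -[X in X - _](Ecst P) -EB//; exact: bm_cst.
  have -> : \int[P]_x g2 x = \int[P]_x g (a + 1 + H x + c0) - 1.
    rewrite -[X in _ - X](Ecst P) -EB; [|exact: bgl|exact: bm_cst].
    apply: eq_E => x; rewrite /g2.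
    have -> // : hi + H x - c0 = a + 1 + H x + c0 by rewrite /hi /lo /wd; ring.
  apply: addr_ge0; apply: mulr_ge0; rewrite ?subr_ge0//.
  - by apply: Rintegral_ge0 => x _; rewrite /p le_max lexx.
  - by apply: Rintegral_ge0 => x _; rewrite /q le_max lexx.
suff : \int[P]_x (p x * g1 x + q x * g2 x) <= dual P (upd h i k) - dual P h.
  by move=> le1; rewrite -subr_ge0; exact: le_trans le1.
rewrite /dual -EB; [|exact: bm_dual_integrand..].
apply: Ele; first by apply: bmD; exact: bmM.
  by apply: bmB; exact: bm_dual_integrand.
move=> x; rewrite /dual_integrand /pot sum_upd (sum_D1 h i) -/(H x).
apply: (clip_gain conj reg); first exact: cc0.
by rewrite lerDl.
Qed.

(** Clipping one potential leaves the others unchanged, so the clips can be iterated. This controls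
    oscillations only, as the position of each interval depends on the other potentials. *)
Lemma dual_oscillation h (r : seq I) x0 x1 : potentials h -> g x0 = 1 -> 1 < g x1 ->
  exists h', [/\ potentials h', dual P h <= dual P h' &
    forall i, i \in r -> exists lo, forall x, lo <= h' i x <= lo + wd].
Proof.
move=> ph gx0 gx1; elim: r => [|i r [h' [ph' hh' osc]]]; first by exists h.
have [M HM] : exists M, forall x, `|\sum_(j | j != i) h' j x| <= M.
  suff [_ +] : bm (fun x => \sum_(j | j != i) h' j x) by [].
  by under eq_fun do rewrite -big_filter; apply: bm_sum => j; exact: bm_h.
have [lo [_ _ hd]] := dual_clip ph' gx0 gx1 HM.
set k := fun x => _ in hd.
have bk : bm k.
  apply: bm_max; first exact: bm_cst.
  by apply: bm_min; [exact: bm_cst|exact: bm_h].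
have dk : dep mix i k by move=> x z; rewrite /k (dep_h i ph').
exists (upd h' i k); split; [exact: potentials_upd|exact: le_trans hd|].
move=> j; rewrite inE /upd; case: eqP => [_ _|_ /= jr]; last exact: osc.
exists lo => x; rewrite /k le_max lexx/= ge_max ge_min lexx/= andbT.
by rewrite lerDl.
Qed.

Definition apriori_cst (x0 x1 : R) : R := `|x0| + `|x1| + c0 + n * wd + 1 + wd.

(** The dual value sees only the sum of the potentials, so constants can be moved between them. All
    but [i0] are shifted into [[0, wd]]; one more clip of [i0] then has a controlled position. *)
Lemma dual_apriori h x0 x1 : potentials h -> g x0 = 1 -> 1 < g x1 ->
  exists h', [/\ potentials h', dual P h <= dual P h' &
    forall i x, `|h' i x| <= apriori_cst x0 x1].
Proof.
move=> ph gx0 gx1.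
have [h1 [ph1 hh1 osc]] := dual_oscillation (enum I) ph gx0 gx1.
have /choice[lo loP] : forall i, exists lo, forall x, lo <= h1 i x <= lo + wd.
  by move=> i; apply: osc; rewrite mem_enum.
have /card_gt0P[i0 _] := I0.
pose s := \sum_(j | j != i0) lo j.
pose h2 j x := h1 j x + (if j == i0 then s else - lo j).
have ph2 : potentials h2.
  move=> j; split; first by apply: bmD; [exact: bm_h|exact: bm_cst].
  by move=> x z; rewrite /h2 (dep_h j ph1).
have sum2 x : \sum_j h2 j x = \sum_j h1 j x.
  rewrite /h2 big_split/= [X in _ + X](bigD1 i0)//= eqxx.
  have -> : \sum_(j | j != i0) (if j == i0 then s else - lo j) = - s.
    by rewrite -sumrN; apply: eq_bigr => j /negbTE ->.
  by rewrite subrr addr0.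
have d2 : dual P h2 = dual P h1.
  by apply: eq_E => x; rewrite /dual_integrand /pot sum2.
have h2b j x : j != i0 -> 0 <= h2 j x <= wd.
  move=> /negbTE ji; rewrite /h2 ji; have /andP[] := loP j x.
  by move=> ? ?; apply/andP; split; lra.
have HM x : `|\sum_(j | j != i0) h2 j x| <= n * wd.
  rewrite ger0_norm; last by apply: sumr_ge0 => j /(h2b j x)/andP[].
  apply: (@le_trans _ _ (\sum_(j : I) wd)).
    rewrite [leRHS](bigID (fun j => j != i0))/= -[leLHS]addr0 lerD//.
      by apply: ler_sum => j /(h2b j x)/andP[].
    by apply: sumr_ge0.
  by rewrite sumr_const -mulr_natl.
have [l [l1 l2 hd]] := dual_clip ph2 gx0 gx1 HM.
set k := fun x => _ in hd.
have bk : bm k.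
  apply: bm_max; first exact: bm_cst.
  by apply: bm_min; [exact: bm_cst|exact: bm_h].
have dk : dep mix i0 k by move=> x z; rewrite /k (dep_h i0 ph2).
exists (upd h2 i0 k); split; first exact: potentials_upd.
  by rewrite (le_trans hh1)// -d2.
have /ler_normlP[a1 a2] := lexx `|x0|; have /ler_normlP[b1 b2] := lexx `|x1|.
have nw0 : 0 <= n * wd by exact: mulr_ge0.
have a0 := normr_ge0 x0; have b0 := normr_ge0 x1; have := c00 => c00'.
move=> j x; rewrite /upd; case: eqP => [_|/eqP ji].
  have : l <= k x <= l + wd.
    rewrite /k le_max lexx/= ge_max ge_min lexx/= andbT lerDl//.
  rewrite ler_norml /apriori_cst => /andP[? ?]; apply/andP; split; lra.
have /andP[? ?] := h2b j x ji.
rewrite ler_norml /apriori_cst; apply/andP; split; lra.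
Qed.

(** A gradient step of length [s = 1 / (2 L)] in [h i] gains at least
    [(s - L s^2) E e^2 = E e^2 / (4 L)], and near-optimality allows a gain of at most [eta]. The
    radius [Y] covers the potential before and after the step. *)
Lemma defect_le h B L eta : potentials h -> (forall i x, `|h i x| <= B) ->
  1 <= L -> (let Y := n * B + c0 + (g (n * B + c0) + 1) in
    forall x y, `|x| <= Y -> `|y| <= Y -> `|g x - g y| <= L * `|x - y|) ->
  (forall h', potentials h' -> dual P h' <= dual P h + eta) ->
  forall i, \int[P]_x defect h i x ^+ 2 <= 4 * L * eta.
Proof.
move=> ph hB L1 Llip hopt i.
pose A := g (n * B + c0).
have A0 : 0 <= A by exact: g0.
have L0 : 0 < L by lra.
pose s := (2 * L)^-1.
have s0 : 0 < s by rewrite invr_gt0; lra.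
have s1 : s <= 1 by rewrite invf_le1; lra.
pose e := defect h i.
have be : bm e by exact: bm_defect.
have de : dep mix i e by move=> x z; rewrite /e /defect dep_Eblk.
have bpot := bm_pot ph.
have bf : bm (fun x => g (pot h x)) by exact: bm_g.
have fA x : g (pot h x) <= A by apply: g_nd; rewrite (le_trans (ler_norm _))// pot_bound.
have eA x : `|e x| <= A + 1.
  have e1 : Eblk mix P i (fun x => g (pot h x)) x <= A.
    rewrite -(Ecst P A).
    apply: Ele => [||z]; [exact: (bm_mixr mmix i x bf)|exact: bm_cst|exact: fA].
  have e0 : 0 <= Eblk mix P i (fun x => g (pot h x)) x by apply: Rintegral_ge0.
  by rewrite ler_norml /e /defect; apply/andP; split; lra.
pose k x := h i x - s * e x.
have bhi := bm_h i ph; have dhi := dep_h i ph.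
have bse : bm (fun x => s * e x) by exact: bmZ.
have bk : bm k by exact: bmB.
have dk : dep mix i k by move=> x z; rewrite /k dhi de.
have pu := potentials_upd ph bk dk.
have be2 : bm (fun x => e x ^+ 2) by exact: bmX.
have bef : bm (fun x => e x * g (pot h x)) by exact: bmM.
have Ee2 : \int[P]_x (e x * g (pot h x) - e x) = \int[P]_x e x ^+ 2.
  rewrite EB// (E_depM mmix mixP be bf de) -EB//; last first.
    by apply: bmM => //; exact: bm_Eblk.
  by apply: eq_E => x; rewrite /e /defect; ring.
have : s * \int[P]_x e x ^+ 2 - L * s ^+ 2 * \int[P]_x e x ^+ 2 <= eta.
  rewrite -{1}Ee2.
  apply: (@le_trans _ _ (dual P (upd h i k) - dual P h)); last first.
    by have := hopt _ pu; lra.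
  rewrite /dual -EB; [|exact: bm_dual_integrand..].
  have b1 : bm (fun x => e x * g (pot h x) - e x) by exact: bmB.
  rewrite -(EZ P s b1) -(EZ P (L * s ^+ 2) be2) -(EB P (bmZ s b1) (bmZ _ be2)).
  apply: Ele; first by apply: bmB; [exact: (bmZ s b1)|exact: (bmZ _ be2)].
    by apply: bmB; exact: bm_dual_integrand.
  move=> x; rewrite /dual_integrand sum_upd (sum_D1 h i).
  have -> : pot (upd h i k) x = pot h x - s * e x.
    by rewrite /pot sum_upd (sum_D1 h i) /k; ring.
  set y := pot h x; set E := e x.
  have se : `|s * E| <= A + 1.
    rewrite normrM gtr0_norm//; apply: (le_trans _ (eA x)).
    by rewrite ler_piMl.
  have yB : `|y| <= n * B + c0 by exact: pot_bound.
  have := psi_tangent conj reg (y - s * E) y.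
  have -> : y - (y - s * E) = s * E by ring.
  rewrite -/g.
  have : `|g y - g (y - s * E)| <= L * `|s * E|.
    have -> : `|s * E| = `|y - (y - s * E)| by congr `|_|; ring.
    apply: Llip; first by rewrite -/A; lra.
    by apply: (le_trans (ler_normB _ _)); rewrite lerD.
  move=> lip.
  have : s * E * (g y - g (y - s * E)) <= L * s ^+ 2 * E ^+ 2.
    rewrite (le_trans (ler_norm _))// normrM.
    apply: (@le_trans _ _ (`|s * E| * (L * `|s * E|))); first by rewrite ler_wpM2l.
    have -> : `|s * E| * (L * `|s * E|) = L * `|s * E| ^+ 2 by ring.
    by rewrite real_normK ?num_real// exprMn mulrA.
  rewrite /k -/E; move=> h1 h2.
  have -> : s * (E * g y - E) = s * E * g y - s * E by ring.
  move: h1 h2; rewrite mulrBr (mulrC (g (y - s * E))).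
  set u1 := s * E * g y; set u2 := s * E * g (y - s * E).
  lra.
have -> : s * \int[P]_x e x ^+ 2 - L * s ^+ 2 * \int[P]_x e x ^+ 2 =
  (4 * L)^-1 * \int[P]_x e x ^+ 2 by rewrite /s; field; rewrite gt_eqF.
by rewrite mulrC ler_pdivrMr ?(mulrC eta)//; lra.
Qed.

(** The bound on [h] is uniform in [eta], because truncation comes after the choice of a
    near-maximizer and does not lower its value. *)
Lemma near_optimal x0 x1 L : g x0 = 1 -> 1 < g x1 -> 1 <= L ->
  (let B := apriori_cst x0 x1 in
   let Y := n * B + c0 + (g (n * B + c0) + 1) in
    forall x y, `|x| <= Y -> `|y| <= Y -> `|g x - g y| <= L * `|x - y|) ->
  forall eta, 0 < eta -> exists h, [/\ potentials h,
    forall i x, `|h i x| <= apriori_cst x0 x1 &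
    forall i, \int[P]_x defect h i x ^+ 2 <= 4 * L * eta].
Proof.
move=> gx0 gx1 L1 Llip eta eta0.
pose S := [set dual P h | h in potentials].
have Ssup : has_sup S.
  split; last by exists c0 => _ [h ph <-]; exact: dual_le.
  exists (dual P (fun _ _ => 0)), (fun _ _ => 0) => // i.
  by split=> //; exact: bm_cst.
have [_ [h ph <-] hS] := sup_adherent eta0 Ssup.
have [h' [ph' hh' hB]] := dual_apriori ph gx0 gx1.
exists h'; split => //; apply: (@defect_le h' (apriori_cst x0 x1) L eta) => //.
move=> h2 ph2; have : dual P h2 <= sup S by apply: ub_le_sup Ssup.2 _ _; exists h2.
lra.
Qed.

End Measure.

End DualFunctional.

(** * Duality bounds for the regularized transport value *)

Section Transport.
Context (R : realType) (N : nat) (d : 'I_N -> nat).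
Local Notation T := (Rvec R (Dtot d)).
Variables (phi psi : R -> R).
Hypothesis conj : conv_conjugates phi psi.
Hypothesis reg : dual_regular psi.
Variables (c : 'rV[R]_(Dtot d) -> R) (X : set T).
Let cX : T -> R := c \_ X.
Variable c0 : R.
Hypotheses (bcX : bm cX) (cX0 : forall x, `|cX x| <= c0).
Local Notation OT := (OTphi phi c X).
Local Notation dual := (dual psi cX).
Local Notation potentials := (potentials (@mix R N d)).

Section ProductMeasure.
Variables (nu : forall i, set (Rvec R (d i)) -> \bar R) (P : probability T R).
Hypotheses (nu1 : forall i, @nu i setT = 1%E) (Pnu : is_prod_meas P (@nu)).

Let mixP i := mix_measure_preserving i Pnu nu1.

Lemma prod_meas_coupling : is_coupling P (@nu).
Proof.
move=> i A mA.
pose B j := if pselect (i = j) is left e then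
    ecast j (set (Rvec R (d j))) e A else setT.
have mB j : measurable (B j) by rewrite /B; case: pselect => // e; case: _ / e.
have -> : [set x : T | A (blk x i)] = [set x | forall j, B j (blk x j)].
  apply/seteqP; split=> x /=.
    by move=> Ax j; rewrite /B; case: pselect => // e; case: _ / e.
  by move=> /(_ i); rewrite /B; case: pselect => // e; rewrite (Prop_irrelevance e erefl).
rewrite Pnu// (bigD1 i)//= big1 ?mule1.
  by rewrite /B; case: pselect => // e; rewrite (Prop_irrelevance e erefl).
move=> j ji; rewrite /B; case: pselect => [e|_]; last exact: nu1.
by rewrite e eqxx in ji.
Qed.

(** Freezing all blocks but [i] at [point] does not change [k], and the images of [pi] and [P] under
    this freezing agree on rectangles. *)
Lemma coupling_E (pi : probability T R) i k : is_coupling pi (@nu) ->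
  bm k -> dep (@mix R N d) i k -> \int[pi]_x k x = \int[P]_x k x.
Proof.
move=> cpi bk dk; have cP := prod_meas_coupling.
pose u := fun x : T => mix i x point.
have mu : measurable_fun setT u.
  apply: (measurableT_comp (measurable_mix i) (g := fun x => (x, point))).
  exact: measurable_fun_pair.
have -> : k = fun x => k (u x) by apply/funext => x; rewrite dk.
have ku : k \o u = k by apply/funext => x; rewrite /= dk.
have E (Q : probability T R) : (\int[Q]_x (k (u x))%:E = \int[pushforward Q u]_x (k x)%:E)%E.
  rewrite integral_pushforward//; first by apply/measurable_EFinP; case: bk.
  by have := bm_integrable Q bk; rewrite -{1}ku.
rewrite /Rintegral !E; congr fine; apply: eq_measure_integral => A mA _.
have h : forall A, measurable A -> pushforward pi u A = pushforward P u A.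
  apply: (@rect_unique R N d (pushforward pi u) (pushforward P u)) => [|{A mA} A mA].
    by rewrite [ltLHS]probability_setT ltry.
  rewrite /= /pushforward.
  have [h|h] := pselect (forall j, j != i -> A j (blk (point : T) j)).
    have -> : u @^-1` rect A = [set x : T | A i (blk x i)].
      apply/seteqP; split=> x; rewrite /u /rect /=.
        by move=> /(_ i); rewrite blk_mix eqxx.
      by move=> Ax j; rewrite blk_mix; case: eqP => [->//|/eqP]; exact: h.
    by rewrite [LHS]cpi// [RHS]cP.
  have -> : u @^-1` rect A = set0; last by rewrite !measure0.
  apply/seteqP; split=> x //; rewrite /u /rect /= => Ax; apply: h => j ji.
  by have := Ax j; rewrite blk_mix (negbTE ji).
exact: h.
Qed.

(** Young's inequality is applied pointwise to the density [f] and [y = pot h]; the marginal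
    constraints then replace the mean of each [h i] under [pi] by its mean under [P]. *)
Lemma weak_duality h : potentials h -> ((dual P h)%:E <= OT (@nu))%E.
Proof.
move=> ph; apply: le_ereal_inf_tmp => _ [P' [pi [f [P'nu cpi [mf f0 piE] ->]]]].
have P'P A : measurable A -> P' A = P A.
  by move=> mA; apply/esym; apply: (prod_meas_unique Pnu P'nu) => //;
    rewrite [ltLHS]probability_setT ltry.
have piE' A : measurable A -> pi A = (\int[P]_(x in A) (f x)%:E)%E.
  move=> mA; rewrite piE//; apply: eq_measure_integral => B mB _; exact: P'P.
rewrite integral_mkcond restrict_EFin -/cX.
have -> : (\int[P']_x (phi (f x))%:E = \int[P]_x (phi (f x))%:E)%E.
  by apply: eq_measure_integral => B mB _; exact: P'P.
pose y := pot cX h.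
have bh i : bm (h i) by case: (ph i).
have by_ : bm y by exact: bm_pot.
have bpsi : bm (fun x => psi (y x)).
  by apply: bm_comp by_; [exact: psi_continuous reg|exact: psi_nd conj reg].
have mfE : measurable_fun setT (EFin \o f) by exact/measurable_EFinP.
have fint : P.-integrable setT (EFin \o f).
  apply/integrableP; split => //.
  under eq_integral do rewrite /= ger0_norm//.
  by rewrite -piE'// probability_setT ltry.
have Eyf : (\int[P]_x (y x * f x)%:E)%E = (\int[pi]_x y x)%R%:E.
  rewrite -EFin_E// (integral_density mf f0 piE')//.
  by apply/measurable_EFinP; case: by_.
have iyf : P.-integrable setT (fun x => (y x * f x)%:E).
  have [my [M yM]] := by_.
  rewrite (_ : (fun x => _) = ((EFin \o y) \* (EFin \o f))%E)//.
  apply: integrableMr => //.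
  exists M; split => [|r Mr x _]; first exact: num_real.
  exact: le_trans (yM x) (ltW Mr).
have low : (\int[P]_x (y x * f x - psi (y x))%:E <= \int[P]_x (phi (f x))%:E)%E.
  apply: le_integral_any => x; rewrite lee_fin.
  by have := young conj (y x) (f0 x); rewrite mulrC; lra.
apply: le_trans (leeD2l _ low).
have -> : (\int[P]_x (y x * f x - psi (y x))%:E)%E =
    (\int[pi]_x y x - \int[P]_x psi (y x))%R%:E.
  under eq_integral do rewrite EFinB.
  rewrite integralB//; last exact: bm_integrable.
  by rewrite Eyf EFin_E.
rewrite EFin_E// -EFinD lee_fin.
have bs : bm (fun x => \sum_i h i x) by exact: bm_sum.
have -> : dual P h = \int[pi]_x (\sum_i h i x) - \int[P]_x psi (y x).
  rewrite /dual /dual_integrand EB//; congr (_ - _); rewrite !Esum//.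
  by apply: eq_bigr => i _; have [bi di] := ph i; rewrite (coupling_E cpi bi di).
rewrite addrA lerD2r -ED// le_eqVlt; apply/orP; left; apply/eqP.
by apply: eq_E => x; rewrite /y /pot; ring.
Qed.

(** A density with all block marginals equal to 1 defines a coupling, as seen by testing with
    indicators of cylinders over one block. *)
Lemma OT_le fh G : bm fh -> bm G -> (forall x, 0 <= fh x) -> \int[P]_x fh x = 1 ->
  (forall i x, Eblk (@mix R N d) P i fh x = 1) ->
  (forall x, cX x * fh x + phi (fh x) <= G x) ->
  (OT (@nu) <= (\int[P]_x G x)%R%:E)%E.
Proof.
move=> bf bG f0 f1 m1 fG.
have [pi piE] := density_probability bf f0 f1.
have mf : measurable_fun setT fh by case: bf.
have cP := prod_meas_coupling.
have bcf : bm (fun x => cX x * fh x) by exact: bmM.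
apply: (@le_trans _ _ (\int[pi]_(x in X) (c x)%:E + \int[P]_x (phi (fh x))%:E)%E).
  apply: ereal_inf_lbound; exists P, pi, fh; split => //.
  move=> i A mA.
  have mA' : measurable [set x : T | A (blk x i)].
    by rewrite -[X in measurable X]setTI; exact: measurable_blk.
  rewrite piE//; set A' := mkset _.
  have -> : (\int[P]_(x in A') (fh x)%:E = \int[P]_x (\1_A' x * fh x)%:E)%E.
    rewrite integral_mkcond; apply: eq_integral => x _.
    by rewrite epatch_indic /= EFinM muleC.
  have bA : bm (\1_A' : T -> R) by exact: bm_indic.
  rewrite EFin_E; last exact: bmM.
  have dA : dep (@mix R N d) i (\1_A' : T -> R).
    move=> x z; rewrite !indicE; congr (_ _)%:R.
    by apply/idP/idP; rewrite !inE /A' /= blk_mix eqxx.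
  rewrite (E_depM (@measurable_mix R N d) mixP bA bf dA).
  under eq_E do rewrite m1 mulr1.
  by rewrite -EFin_E// integral_indic// setIT; exact: cP.
rewrite integral_mkcond restrict_EFin -/cX.
rewrite (integral_density mf f0 piE); last by apply/measurable_EFinP; case: bcX.
rewrite (_ : (fun x => _ * _)%E = (fun x => (cX x * fh x)%:E))//.
rewrite (EFin_E P bcf).
have : (\int[P]_x (phi (fh x))%:E <= \int[P]_x (G x - cX x * fh x)%:E)%E.
  by apply: le_integral_any => x; rewrite lee_fin; have := fG x; lra.
rewrite (EFin_E P (bmB bG bcf)) (EB P bG bcf) => h; apply: le_trans (leeD2l _ h) _.
by rewrite -EFinD lee_fin addrC subrK.
Qed.

Lemma OT_le_cst : (OT (@nu) <= c0%:E)%E.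
Proof.
have [_ _ phi1 _ _] := conj.
apply: le_trans (@OT_le (fun=> 1) cX _ bcX _ _ _ _) _ => //.
- exact: bm_cst.
- exact: Ecst.
- by move=> i x; exact: Ecst.
- by move=> x; rewrite phi1 mulr1 addr0.
rewrite lee_fin -[leRHS](Ecst P); apply: Ele => //; first exact: bm_cst.
by move=> x; rewrite (le_trans (ler_norm _)).
Qed.

Lemma OT_value : exists2 v, OT (@nu) = v%:E &
  v <= c0 /\ forall h, potentials h -> dual P h <= v.
Proof.
have p0 : potentials (fun (_ : 'I_N) (_ : T) => 0 : R) by move=> i; split => //; exact: bm_cst.
have l := weak_duality p0; have u := OT_le_cst.
have fin : OT (@nu) \is a fin_num.
  by rewrite fin_numE -ltNye -ltey (lt_le_trans _ l) ?ltNyr// (le_lt_trans u) ?ltry.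
exists (fine (OT (@nu))); first by rewrite fineK.
split; first by rewrite -lee_fin fineK.
by move=> h ph; rewrite -lee_fin [leRHS]fineK//; exact: weak_duality.
Qed.

(** The first entry serves [t <= 1], where the primal competitor exists; the second bounds the whole
    gap between [c0] and the dual value and serves [t > 1]. *)
Definition stability_cst (K B : R) : R :=
  Num.max (primal_cst 'I_N psi c0 K B)
    (c0 + (N%:R * B + `|psi (N%:R * B + c0)|)).

Lemma OT_stability K B h t : 0 <= K ->
  (forall x, 0 <= x -> phi x <= K * (1 + x ^+ 2)) -> (0 < N)%N ->
  potentials h -> (forall i x, `|h i x| <= B) -> 0 < t ->
  (forall i, \int[P]_x defect (@mix R N d) psi cX P h i x ^+ 2 <= t ^+ 2) ->
  exists2 v, OT (@nu) = v%:E & `|v - dual P h| <= stability_cst K B * t.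
Proof.
move=> K0 Kphi N0 ph hB t0 ht.
have I0 : (0 < #|'I_N|)%N by rewrite card_ord.
have [v OTv [vc0 vd]] := OT_value; exists v => //.
have vdh := vd _ ph.
rewrite ger0_norm ?subr_ge0// lerBlDl.
have [t1|t1] := leP t 1; last first.
  have := @dual_ge _ _ R _ _ phi psi conj reg cX c0 bcX cX0 P h B ph hB.
  rewrite card_ord => hd.
  set M := c0 + (N%:R * B + `|psi (N%:R * B + c0)|).
  have M0 : 0 <= M by rewrite /M; lra.
  have h1 : M <= M * t by rewrite ler_peMr// ltW.
  have h2 : M * t <= stability_cst K B * t.
    by rewrite ler_wpM2r ?(ltW t0)// /stability_cst le_max lexx orbT.
  by move: h1; rewrite {1}/M; lra.
have t01 : 0 < t <= 1 by rewrite t0.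
have [fh [G [bf bG f0 m1 [fG EG]]]] :=
  primal_competitor (@measurable_mix R N d) (@mixl R N d) (@mixr R N d)
    conj reg bcX cX0 I0 mixP K0 Kphi ph hB t01 ht.
have /card_gt0P[i0 _] := I0.
have f1 : \int[P]_x fh x = 1.
  rewrite -(E_Eblk (@measurable_mix R N d) mixP i0 bf) -[RHS](Ecst P).
  by apply: eq_E => x; rewrite m1.
have := OT_le bf bG f0 f1 m1 fG; rewrite OTv lee_fin => h1.
apply: (le_trans h1); apply: (le_trans EG); rewrite lerD2l ler_wpM2r ?(ltW t0)//.
by rewrite /stability_cst le_max lexx.
Qed.

End ProductMeasure.

End Transport.

(** * Uniform measures on finite families *)

Section FiniteAverage.
Context d (T : measurableType d) (R : realType) (K : finType) (y : K -> T).
Hypothesis K0 : (0 < #|K|)%N.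

Definition avg (f : T -> R) : R := #|K|%:R^-1 * \sum_k f (y k).

(** A sequence enumerating the family, as [msum] expects one; the default [point] occurs only from
    rank [#|K|] on, outside the sum. *)
Let yn (i : nat) : T := if insub i is Some j then y (enum_val (j : 'I_#|K|)) else point.

Let sum_yn (V : nmodType) (f : T -> V) : \sum_(i < #|K|) f (yn i) = \sum_k f (y k).
Proof.
rewrite [RHS](reindex (@enum_val K predT))/=; last exact/onW_bij/enum_val_bij.
by apply: eq_bigr => i _; rewrite /yn valK.
Qed.

Let r0 : 0 <= (#|K|%:R : R)^-1. Proof. by rewrite invr_ge0. Qed.

Definition average_measure : set T -> \bar R :=
  mscale (NngNum r0) (msum (fun i => \d_(yn i)) #|K|).

HB.instance Definition _ := Measure.on average_measure.

Let average_measureE A : measurable A -> average_measure A = (avg \1_A)%:E.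
Proof.
move=> mA; rewrite /average_measure /= /mscale /= /msum /avg EFinM; congr (_ * _)%E.
by rewrite -sum_yn sumEFin; congr EFin.
Qed.

Let average_measure_setT : average_measure setT = 1%E.
Proof.
rewrite average_measureE// /avg (eq_bigr (fun=> 1)); last by move=> k _; rewrite indicE in_setT.
by rewrite sumr_const mulVf// pnatr_eq0 -lt0n.
Qed.

HB.instance Definition _ := @Measure_isProbability.Build _ _ R
  average_measure average_measure_setT.

Lemma average_probability : exists Q : probability T R,
  (forall A, measurable A -> Q A = (avg \1_A)%:E) /\
  (forall f, bm f -> \int[Q]_x f x = avg f).
Proof.
pose Q := [the probability T R of average_measure].
exists Q; split; first exact: average_measureE.
(* Nonnegative functions first; a bounded one becomes nonnegative after adding a constant. *)
have nn f : bm f -> (forall x, 0 <= f x) -> \int[Q]_x f x = avg f.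
  move=> [mf _] f0; rewrite /Rintegral.
  have mfE : measurable_fun setT (EFin \o f) by exact/measurable_EFinP.
  have fE0 x : [set: T] x -> (0 <= (f x)%:E)%E by move=> _; rewrite lee_fin.
  have -> : (\int[Q]_x (f x)%:E = (avg f)%:E)%E; last by [].
  transitivity (\int[mscale (NngNum r0) (msum (fun i => \d_(yn i)) #|K|)]_x (f x)%:E)%E => //.
  rewrite ge0_integral_mscale//.
  rewrite ge0_integral_measure_sum//.
  rewrite /avg EFinM; congr (_ * _)%E; rewrite -sum_yn -sumEFin.
  by apply: eq_bigr => i _; rewrite integral_dirac// diracT mul1e.
move=> f bf; have [M [M0 fM]] := bm_le bf.
have bM : bm (fun _ : T => M) by exact: bm_cst.
have f0 x : 0 <= f x + M by have := fM x; rewrite ler_norml => /andP[]; lra.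
have h := nn _ (bmD bf bM) f0; rewrite (ED Q bf bM) Ecst in h.
apply: (addIr M); rewrite h.
rewrite /avg big_split/= mulrDr sumr_const -[X in _ + _ * X]mulr_natl mulKf//.
by rewrite pnatr_eq0 -lt0n.
Qed.

End FiniteAverage.

(** * Counting pairs of multi-indices that share a sample *)

Section Counting.
Context (R : realType) (N n : nat).
Local Notation K := {ffun 'I_N -> 'I_n}.
Hypothesis n0 : (0 < n)%N.

Definition meets (k l : K) : bool := [exists i, k i == l i].

Lemma card_indices : #|{: K}| = (n ^ N)%N.
Proof. by rewrite card_ffun !card_ord. Qed.

(** Prescribing one coordinate selects a fraction [1 / n] of the multi-indices: the sum over
    functions of a product is a product of sums. *)
Lemma count_coordinate (i : 'I_N) (a : 'I_n) :
  n%:R * \sum_(l : K) (l i == a)%:R = #|{: K}|%:R :> R.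
Proof.
pose F (j : 'I_N) (k : 'I_n) : R := if j == i then (k == a)%:R else 1.
have -> : \sum_(l : K) (l i == a)%:R = \sum_(l : K) \prod_j F j (l j).
  apply: eq_bigr => l _; rewrite (bigD1 i)//= {1}/F eqxx big1 ?mulr1//.
  by move=> j /negbTE ji; rewrite /F ji.
rewrite -bigA_distr_bigA /= (bigD1 i)//= mulrA.
have -> : \sum_k F i k = 1.
  rewrite (bigD1 a)//= {1}/F !eqxx big1 ?addr0// => k /negbTE ka.
  by rewrite /F eqxx ka.
rewrite mulr1 (eq_bigr (fun=> n%:R)); last first.
  move=> j /negbTE ji; rewrite (eq_bigr (fun=> 1)) ?sumr_const ?card_ord//.
  by move=> k _; rewrite /F ji.
rewrite card_indices natrX -[in RHS](card_ord N) -prodr_const.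
by rewrite [RHS](bigD1 i).
Qed.

Lemma count_meets : n%:R * \sum_(k : K) \sum_(l : K) (meets k l)%:R
  <= N%:R * #|{: K}|%:R ^+ 2 :> R.
Proof.
rewrite mulr_sumr.
apply: (@le_trans _ _ (\sum_(k : K) N%:R * #|{: K}|%:R)).
  apply: ler_sum => k _.
  apply: (@le_trans _ _ (n%:R * \sum_(l : K) \sum_(i < N) (l i == k i)%:R)).
    rewrite ler_wpM2l//; apply: ler_sum => l _.
    have [/existsP[i /eqP kl]|_] := boolP (meets k l); last by apply: sumr_ge0.
    by rewrite (bigD1 i)//= kl eqxx lerDl sumr_ge0.
  rewrite exchange_big/= mulr_sumr (eq_bigr (fun=> #|{: K}|%:R)).
    by rewrite sumr_const card_ord mulr_natl.
  by move=> i _; exact: count_coordinate.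
by rewrite sumr_const -[leLHS]mulr_natl expr2 [leRHS]mulrCA lexx.
Qed.

End Counting.

Lemma pushforward_probability d1 d2 (S : measurableType d1) (T : measurableType d2)
  (R : realType) (Q : probability S R) (u : S -> T) : measurable_fun setT u ->
  exists P : probability T R, forall A, P A = Q (u @^-1` A).
Proof.
move=> mu; pose X : {mfun S >-> T} := mfun_Sub (mem_set mu).
by exists [the probability T R of distribution Q X].
Qed.

(** * Second moments of averages over multi-indices *)

Section Sampling.
Context (R : realType) (N : nat) (d : 'I_N -> nat) (n : nat).
Local Notation T := (Rvec R (Dtot d)).
Local Notation K := {ffun 'I_N -> 'I_n}.
Context (dO : measure_display) (Om : measurableType dO) (PO : probability Om R).
Variable Y : forall i : 'I_N, 'I_n -> Om -> Rvec R (d i).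
Variable mu : forall i : 'I_N, probability (Rvec R (d i)) R.
Hypotheses (n0 : (0 < n)%N) (mY : forall i k, measurable_fun setT (@Y i k)).
Hypothesis lawY : forall i k A, measurable A -> PO (@Y i k @^-1` A) = @mu i A.
Hypothesis indY : mutually_indep PO Y.

Definition sample (k : K) (w : Om) : T := joinT (fun i => @Y i (k i) w).

Lemma blk_sample k w i : blk (sample k w) i = @Y i (k i) w.
Proof. exact: blk_join. Qed.

Lemma measurable_sample k : measurable_fun setT (sample k).
Proof.
apply: measurable_fun_blocks => i; under eq_fun do rewrite blk_sample.
exact: mY.
Qed.

Definition mixk (i : 'I_N) (k l : K) : K := [ffun j => if j == i then k j else l j].

Lemma sample_mixk i k l w : sample (mixk i k l) w = mix i (sample k w) (sample l w).
Proof.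
apply: blk_inj => j; rewrite blk_sample blk_mix !blk_sample ffunE.
by case: eqP.
Qed.

Let mpre k A : measurable A -> measurable (sample k @^-1` A).
Proof.
by move=> mA; rewrite -[X in measurable X]setTI; exact: measurable_sample.
Qed.

Lemma sample_rect k A : (forall i, measurable (A i)) ->
  PO (sample k @^-1` rect A) = \big[*%E/1%E]_i (@mu i (A i)).
Proof.
move=> mA; pose B i j := if j == k i then A i else setT.
have mB i j : measurable (B i j) by rewrite /B; case: eqP => // _; exact: measurableT.
have -> : sample k @^-1` rect A = [set w | forall i j, B i j (@Y i j w)].
  apply/seteqP; split=> w; rewrite /rect /=.
    by move=> h i j; rewrite /B; case: eqP => // ->; rewrite -blk_sample.
  by move=> h i; rewrite blk_sample; have := h i (k i); rewrite /B eqxx.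
rewrite indY//; apply: eq_bigr => i _.
rewrite (bigD1 (k i))//= [X in PO (_ @^-1` X)]/B eqxx lawY// big1 ?mule1//.
by move=> j /negbTE jk; rewrite /B jk preimage_setT probability_setT.
Qed.

(** The law of a single tuple of samples, one per block, is the product measure. *)
Lemma exists_product : exists P : probability T R, is_prod_meas P mu.
Proof.
pose k0 : K := [ffun=> Ordinal n0].
have [P PE] := pushforward_probability PO (measurable_sample k0).
by exists P => A mA; rewrite PE; exact: sample_rect.
Qed.

Variable P : probability T R.
Hypothesis Pmu : is_prod_meas P mu.

Let mixP i := mix_measure_preserving i Pmu (fun j => probability_setT (@mu j)).

Let rect_ext (m : {measure set T -> \bar R}) (c : {nonneg R}) :
  (forall A, (forall i, measurable (A i)) -> m (rect A) = (c%:num%:E * P (rect A))%E) ->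
  forall A, measurable A -> m A = (c%:num%:E * P A)%E.
Proof.
move=> h; suff : forall A, measurable A -> m A = mscale c P A by [].
apply: rect_unique => //.
have -> : setT = rect (fun i => setT : set (Rvec R (d i))).
  by apply/seteqP; split.
rewrite h; last by move=> i; exact: measurableT.
by rewrite lte_mul_pinfty ?lee_fin// (le_lt_trans (probability_le1 P _)) ?ltry//;
  apply: measurable_rect => i; exact: measurableT.
Qed.

Lemma sample_joint_rect k l A B : ~~ meets k l ->
  (forall i, measurable (A i)) -> (forall i, measurable (B i)) ->
  PO (sample k @^-1` rect A `&` sample l @^-1` rect B) = (P (rect A) * P (rect B))%E.
Proof.
move=> kl mA mB.
pose C i j := if j == k i then A i else if j == l i then B i else setT.
have mC i j : measurable (C i j).
  by rewrite /C; case: eqP => // _; case: eqP => // _; exact: measurableT.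
have kli i : (l i == k i) = false.
  by apply/negbTE; apply: contraNneq kl => e; apply/existsP; exists i; rewrite e.
have -> : sample k @^-1` rect A `&` sample l @^-1` rect B =
    [set w | forall i j, C i j (@Y i j w)].
  apply/seteqP; split=> w; rewrite /rect /=.
    move=> [h1 h2] i j; rewrite /C; case: eqP => [->|_]; first by rewrite -blk_sample.
    by case: eqP => // ->; rewrite -blk_sample.
  move=> h; split=> i; rewrite blk_sample.
    by have := h i (k i); rewrite /C eqxx.
  by have := h i (l i); rewrite /C kli eqxx.
rewrite indY// [X in (X * _)%E]Pmu// [X in (_ * X)%E]Pmu// -big_split/=.
apply: eq_bigr => i _.
rewrite (bigD1 (k i))//= (bigD1 (l i)) ?kli//=.
have Ck : C i (k i) = A i by rewrite /C eqxx.
have Cl : C i (l i) = B i by rewrite /C kli eqxx.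
rewrite Ck Cl !lawY// big1 ?mule1//.
by move=> j /andP[/negbTE jk /negbTE jl]; rewrite /C jk jl preimage_setT probability_setT.
Qed.

(** Extends from rectangles one argument at a time: with the other event fixed, both sides are
    finite measures in the remaining set, one a multiple of [P]. *)
Lemma sample_joint k l A B : ~~ meets k l -> measurable A -> measurable B ->
  PO (sample k @^-1` A `&` sample l @^-1` B) = (P A * P B)%E.
Proof.
move=> kl mA mB.
have PBn D : measurable D -> exists c : {nonneg R}, P D = c%:num%:E.
  move=> mD; have c0 : 0 <= fine (P D) by exact: fine_ge0.
  by exists (NngNum c0); rewrite /= fineK// fin_num_measure.
have mk := measurable_sample k; have ml := measurable_sample l.
have step1 B' : (forall i, measurable (B' i)) ->
    PO (sample k @^-1` A `&` sample l @^-1` rect B') = (P A * P (rect B'))%E.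
  move=> mB'; have mrB := measurable_rect mB'.
  have [c Pc] := PBn _ mrB; rewrite Pc muleC.
  have mE := mpre l mrB.
  suff : forall A, measurable A ->
      pushforward (mrestr PO mE) (sample k) A = (c%:num%:E * P A)%E by exact.
  apply: rect_ext => A' mA'; rewrite -Pc muleC.
  exact: sample_joint_rect.
have [c Pc] := PBn _ mA; rewrite Pc.
have mE := mpre k mA; rewrite setIC.
suff : forall B, measurable B ->
    pushforward (mrestr PO mE) (sample l) B = (c%:num%:E * P B)%E by exact.
apply: rect_ext => B' mB'; rewrite -Pc -step1//.
by rewrite /= /pushforward /mrestr setIC.
Qed.

Lemma E_sample2 k l (F : T * T -> R) : ~~ meets k l -> bm F ->
  \int[PO]_w F (sample k w, sample l w) = \int[P]_x \int[P]_z F (x, z).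
Proof.
move=> kl bF; rewrite -E_fubini//; apply/esym.
have mkl : measurable_fun setT (fun w => (sample k w, sample l w)).
  by apply: measurable_fun_pair; exact: measurable_sample.
apply: (E_pushforward (u := fun w => (sample k w, sample l w))) => //.
suff : forall A, measurable A -> (P \x P)%E A =
    pushforward PO (fun w => (sample k w, sample l w)) A by [].
apply: product_measure_unique => A B mA mB.
exact: sample_joint.
Qed.

Definition savg (F : T -> R) (w : Om) : R := avg (sample ^~ w) F.

Lemma bm_sample k (F : T -> R) : bm F -> bm (fun w => F (sample k w)).
Proof. by move=> bF; apply: bm_precomp (measurable_sample k) bF. Qed.

Lemma bm_savg (F : T -> R) : bm F -> bm (savg F).
Proof. by move=> bF; apply: bmZ; apply: bm_sum => k; exact: bm_sample. Qed.

Lemma card_indices_gt0 : (0 < #|{: K}|)%N.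
Proof. by rewrite card_indices expn_gt0 n0. Qed.

Let q : R := #|{: K}|%:R.

Let q0 : 0 < q. Proof. by rewrite ltr0n card_indices_gt0. Qed.

(** The extra amount [b] is paid only by meeting pairs, a fraction of at most [N / n] of all
    pairs. *)
Lemma pair_average (G : K -> K -> Om -> R) a b : (forall k l, bm (G k l)) -> 0 <= b ->
  (forall k l, \int[PO]_w G k l w <= a + b * (meets k l)%:R) ->
  \int[PO]_w (q^-1 ^+ 2 * \sum_(k : K) \sum_(l : K) G k l w) <= a + b * (N%:R / n%:R).
Proof.
move=> bG b0 hG; rewrite EZ; last by apply: bm_sum => k; exact: bm_sum.
rewrite Esum; last by move=> k; exact: bm_sum.
apply: (@le_trans _ _ (q^-1 ^+ 2 * \sum_(k : K) \sum_(l : K) (a + b * (meets k l)%:R))).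
  rewrite ler_wpM2l ?sqr_ge0//; apply: ler_sum => k _.
  by rewrite Esum//; apply: ler_sum => l _.
have -> : \sum_(k : K) \sum_(l : K) (a + b * (meets k l)%:R) =
    q ^+ 2 * a + b * \sum_(k : K) \sum_(l : K) (meets k l)%:R.
  have inner k : \sum_(l : K) (a + b * (meets k l)%:R) =
      q * a + b * \sum_(l : K) (meets k l)%:R.
    by rewrite big_split/= sumr_const -[X in X + _]mulr_natl mulr_sumr.
  transitivity (\sum_(k : K) (q * a + b * \sum_(l : K) (meets k l)%:R)).
    by apply: eq_bigr => k _; rewrite -inner.
  by rewrite big_split/= sumr_const -[X in X + _]mulr_natl mulrA expr2 -mulr_sumr.
rewrite mulrDr mulrA -exprMn mulVf ?gt_eqF// expr1n mul1r lerD2l mulrCA ler_wpM2l//.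
have nn : (0 : R) < n%:R by rewrite ltr0n.
rewrite ler_pdivlMr// mulrC mulrCA exprVn mulrC ler_pdivrMr ?exprn_gt0//.
exact: count_meets.
Qed.

(** In the expanded square, pairs that do not meet are independent and centred; the others
    contribute at most [M^2] each. *)
Lemma E_savg_sq (F : T -> R) M : bm F -> (forall x, `|F x| <= M) -> \int[P]_x F x = 0 ->
  \int[PO]_w savg F w ^+ 2 <= M ^+ 2 * (N%:R / n%:R).
Proof.
move=> bF FM F0.
have -> : (fun w => savg F w ^+ 2) = (fun w => q^-1 ^+ 2 * \sum_(k : K) \sum_(l : K)
    F (sample k w) * F (sample l w)).
  apply/funext => w; rewrite /savg /avg exprMn; congr (_ * _).
  by rewrite expr2 big_distrlr.
rewrite -[leRHS]add0r; apply: (pair_average (a := 0)).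
- by move=> k l; apply: bmM; exact: bm_sample.
- exact: sqr_ge0.
move=> k l; rewrite add0r; case: (boolP (meets k l)) => kl; last first.
  have bFF : bm (fun p : T * T => F p.1 * F p.2).
    by apply: bmM; apply: bm_precomp bF.
  rewrite mulr0 (E_sample2 kl bFF) /=.
  rewrite (eq_E P (g := fun x => 0 * F x)) ?EZ ?mul0r// => x.
  by rewrite EZ// F0 mulr0 mul0r.
rewrite mulr1 -[leRHS](Ecst PO); apply: Ele; [|exact: bm_cst|].
  by apply: bmM; exact: bm_sample.
move=> w; rewrite (le_trans (ler_norm _))// normrM expr2 ler_pM//.
Qed.

(** For a fixed outer index [k] the inner square expands over pairs [(l, l')]. If these do not meet,
    the two sample points share exactly the observation of block [i], and the mean product is the
    population second moment. *)
Lemma E_block_defect i (f : T -> R) M : (1 < n)%N -> bm f -> (forall x, `|f x - 1| <= M) ->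
  \int[PO]_w savg (fun x => (savg (fun z => f (mix i x z)) w - 1) ^+ 2) w <=
  \int[P]_x (Eblk (@mix R N d) P i f x - 1) ^+ 2 + M ^+ 2 * (N%:R / n%:R).
Proof.
move=> n1 bf fM; set a := \int[P]_x _.
pose h x := f x - 1.
have bh : bm h by apply: bmB => //; exact: bm_cst.
pose G k l l' w := h (sample (mixk i k l) w) * h (sample (mixk i k l') w).
have bG k l l' : bm (G k l l') by apply: bmM; exact: bm_sample.
have sE w x : (exists k, x = sample k w) ->
    savg (fun z => f (mix i x z)) w - 1 = q^-1 * \sum_(l : K) h (mix i x (sample l w)).
  move=> _; rewrite /savg /avg /h big_split/= sumr_const mulrDr -/q.
  by rewrite -[X in _ = _ + _ * X]mulr_natl mulrN1 mulrN mulVf// gt_eqF.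
have -> : (fun w => savg (fun x => (savg (fun z => f (mix i x z)) w - 1) ^+ 2) w) =
    (fun w => q^-1 * \sum_(k : K) (q^-1 ^+ 2 * \sum_(l : K) \sum_(l' : K) G k l l' w)).
  apply/funext => w; rewrite [LHS]/savg /avg -/q; congr (_ * _).
  apply: eq_bigr => k _; rewrite sE; last by exists k.
  rewrite exprMn; congr (_ * _); rewrite expr2 big_distrlr/=.
  by apply: eq_bigr => l _; apply: eq_bigr => l' _; rewrite /G !sample_mixk.
have bGs k : bm (fun w => q^-1 ^+ 2 * \sum_(l : K) \sum_(l' : K) G k l l' w).
  by apply: bmZ; apply: bm_sum => l; exact: bm_sum.
rewrite EZ; last exact: bm_sum.
rewrite Esum//.
apply: (@le_trans _ _ (q^-1 * \sum_(k : K) (a + M ^+ 2 * (N%:R / n%:R)))); last first.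
  by rewrite sumr_const -[X in _ * X <= _]mulr_natl mulKf// gt_eqF.
rewrite ler_wpM2l ?invr_ge0 ?(ltW q0)//; apply: ler_sum => k _.
apply: pair_average => // [|l l']; first exact: sqr_ge0.
have a0 : 0 <= a by apply: Rintegral_ge0 => x _; exact: sqr_ge0.
case: (boolP (meets l l')) => ll; last first.
  rewrite mulr0 addr0.
  (* Entry [i] of [l'] is overwritten in the mixed point, so it may be changed to avoid [k i]; then
     the pair does not meet and is independent. A second value in ['I_n] exists as [1 < n]. *)
  have [b bk] : exists b, b != k i.
    have [k0|k0] := eqVneq (k i) (Ordinal n0).
      by exists (Ordinal n1); rewrite k0.
    by exists (Ordinal n0); rewrite eq_sym.
  pose l2 : K := [ffun j => if j == i then b else l' j].
  have dis : ~~ meets (mixk i k l) l2.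
    apply/existsP => -[j]; rewrite !ffunE; case: (eqVneq j i) => [->|_ e].
      by rewrite eq_sym (negbTE bk).
    by move/negP: ll; apply; apply/existsP; exists j.
  have bF : bm (fun p : T * T => h p.1 * h (mix i p.1 p.2)).
    apply: bmM; first by apply: bm_precomp bh.
    by apply: (bm_precomp (u := fun p : T * T => mix i p.1 p.2)) bh; exact: measurable_mix.
  have -> : G k l l' = (fun w => h (sample (mixk i k l) w) *
      h (mix i (sample (mixk i k l) w) (sample l2 w))).
    apply/funext => w; rewrite /G; congr (_ * h _).
    rewrite -sample_mixk; congr sample; apply/ffunP => j; rewrite !ffunE.
    by case: eqP => // ->; rewrite eqxx.
  rewrite (E_sample2 dis bF) /= /a le_eqVlt; apply/orP; left; apply/eqP.
  have bE : bm (Eblk (@mix R N d) P i h) by exact: bm_Eblk (@measurable_mix R N d) _ _ _ bh.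
  have EE x : Eblk (@mix R N d) P i h x = Eblk (@mix R N d) P i f x - 1.
    rewrite EblkB//; [|exact: measurable_mix|exact: bm_cst].
    by rewrite {2}/Eblk Ecst.
  transitivity (\int[P]_x (Eblk (@mix R N d) P i h x * h x)).
    apply: eq_E => x; rewrite EZ; last exact: (bm_mixr (@measurable_mix R N d) i x bh).
    exact: mulrC.
  have dE : dep (@mix R N d) i (Eblk (@mix R N d) P i h).
    by apply: dep_Eblk; exact: mixl.
  rewrite (E_depM (@measurable_mix R N d) mixP bE bh dE).
  by apply: eq_E => x; rewrite EE expr2.
rewrite mulr1; apply: (@le_trans _ _ (M ^+ 2)); last by rewrite lerDr.
rewrite -[leRHS](Ecst PO); apply: Ele => //; first exact: bm_cst.
by move=> w; rewrite (le_trans (ler_norm _))// normrM expr2 ler_pM//; exact: fM.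
Qed.

Lemma bm_block_defect i (f : T -> R) : bm f ->
  bm (fun w => savg (fun x => (savg (fun z => f (mix i x z)) w - 1) ^+ 2) w).
Proof.
move=> bf; apply: bmZ; apply: bm_sum => k; apply: bmX; apply: bmB; last exact: bm_cst.
apply: bmZ; apply: bm_sum => l; under eq_fun do rewrite -sample_mixk.
exact: bm_sample.
Qed.

(** Expanding a product of averages gives the average over all multi-indices, so the product of the
    empirical measures is uniform on the sample tuples. *)
Lemma empirical_product : exists Q : Om -> probability T R, forall w,
  is_prod_meas (Q w) (fun i => empirical (fun k => @Y i k w)) /\
  forall f : T -> R, bm f -> \int[Q w]_x f x = savg f w.
Proof.
suff /choice : forall w, exists Q : probability T R,
    is_prod_meas Q (fun i => empirical (fun k => @Y i k w)) /\
    forall f : T -> R, bm f -> \int[Q]_x f x = savg f w by move=> [Q QP]; exists Q.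
move=> w; have [Q [Q1 Q2]] := @average_probability _ T R K (sample ^~ w) card_indices_gt0.
exists Q; split => // A mA.
have mr : measurable [set x : T | forall i, A i (blk x i)] by exact: measurable_rect.
rewrite Q1// /empirical /avg.
pose p i : R := n%:R^-1 * \sum_(k < n) \1_(A i) (@Y i k w).
have -> : \big[*%E/1%E]_(i < N) (p i)%:E = (\prod_(i < N) p i)%:E.
  by apply: (big_ind2 (fun (x : \bar R) (y : R) => x = y%:E)) => // x1 x2 y1 y2 -> ->.
congr (_%:E); rewrite /p big_split/= prodr_const card_ord bigA_distr_bigA/=.
rewrite card_indices natrX exprVn; congr (_ * _); apply: eq_bigr => k _.
rewrite indicE.
have [h|h] := pselect (forall i, A i (@Y i (k i) w)).
  rewrite mem_set; last by move=> i; rewrite blk_sample.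
  by rewrite big1// => i _; rewrite indicE mem_set.
rewrite memNset; last by move=> h'; apply: h => i; rewrite -blk_sample.
have /existsNP[i hi] := h.
by rewrite (bigD1 i)//= indicE memNset// mul0r.
Qed.

End Sampling.

(** * The cost extended by zero from the compact product *)

Section CompactCost.
Context (R : realType) (N : nat) (d : 'I_N -> nat).
Variable X : forall i, set 'rV[R]_(d i).
Hypothesis cX : forall i, compact (@X i).

Lemma continuous_blk i : continuous (fun x : 'rV[R]_(Dtot d) => blk x i).
Proof.
move=> x A /nbhs_ballP[e /= e0 eA]; apply/nbhs_ballP; exists e => // y [_ xy].
by apply: eA; split=> // a b; rewrite (ord1 a) !blkE; exact: xy.
Qed.

Lemma closed_Xprod : closed (Xprod X : set 'rV[R]_(Dtot d)).
Proof.
have -> : (Xprod X : set 'rV[R]_(Dtot d)) = \bigcap_i ((fun x => blk x i) @^-1` @X i).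
  by apply/seteqP; split=> [x h i _|x h i]; apply: h.
apply: closed_bigI => i _; apply: preimage_closed => [x _|]; first exact: continuous_blk.
by apply: compact_closed => //; exact: norm_hausdorff.
Qed.

Lemma compact_Xprod : compact (Xprod X : set 'rV[R]_(Dtot d)).
Proof.
pose A (k : 'I_(Dtot d)) :=
  (fun v : 'rV[R]_(d (tagnat.sig1 k)) => v 0 (tagnat.sig2 k)) @` @X (tagnat.sig1 k).
apply: (subclosed_compact closed_Xprod (@rV_compact _ _ A _)) => [k|x Xx k].
  apply: continuous_compact; last exact: cX.
  by apply: continuous_subspaceT; exact: coord_continuous.
by exists (blk x (tagnat.sig1 k)); [exact: Xx|rewrite -coord_blk].
Qed.

Lemma bm_cost s (c : 'rV[R]_(Dtot d) -> R) : Cs_set (Xprod X) s c ->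
  bm ((c : Rvec R (Dtot d) -> R) \_ (Xprod X)).
Proof.
move=> [U [g [oU XU [_ cg] gc]]].
have {}cg x : U x -> {for x, continuous g} by exact: (cg [::]).
have -> : c \_ (Xprod X) = g \_ (Xprod X).
  apply/funext => x; rewrite /patch; case: ifPn => // /set_mem Xx.
  by rewrite gc.
have mX : measurable (Xprod X).
  rewrite -[X in measurable X]setCK; apply: measurableC.
  by apply: sub_sigma_algebra; exact/closed_openC/closed_Xprod.
split.
  apply/(measurable_restrictT _ mX).
  apply: (measurability _ (RGenOInfty.measurableE R)) => _ [_ [a ->]] <-.
  (* [g] is continuous only at points of [U], so its superlevel set is intersected with [U] to be
     open. *)
  rewrite (_ : _ `&` _ = Xprod X `&` (U `&` g @^-1` `]a, +oo[)).
    apply: measurableI => //; apply: sub_sigma_algebra.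
    rewrite openE => x [Ux gx]; apply: filterI; first exact: open_nbhs_nbhs.
    apply: (cg x Ux); apply: open_nbhs_nbhs; split; last exact: gx.
    exact: interval_open.
  by apply/seteqP; split=> x [Xx]; [move=> gx; split => //; split => //; exact: XU|case].
have [M [_ hM]] : bounded_set (g @` (Xprod X)).
  apply: compact_bounded; apply: continuous_compact; last exact: compact_Xprod.
  by apply: continuous_in_subspaceT => x /set_mem Xx; apply: cg; exact: XU.
exists (`|M| + 1) => x; rewrite /patch; case: ifPn => [/set_mem Xx|_].
  apply: (hM (`|M| + 1)); last by exists x.
  by rewrite (le_lt_trans (ler_norm _))// ltrDl.
by rewrite normr0 addr_ge0.
Qed.

End CompactCost.

(** * The expected error for a growing sample *)

Section Rate.
Context (R : realType) (N : nat) (d : 'I_N -> nat).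
Local Notation T := (Rvec R (Dtot d)).
Variables (phi psi : R -> R).
Hypothesis conj : conv_conjugates phi psi.
Hypothesis reg : dual_regular psi.
Variables (c : 'rV[R]_(Dtot d) -> R) (X : set T) (c0 : R).
Let cX : T -> R := c \_ X.
Hypotheses (bcX : bm cX) (cX0 : forall x, `|cX x| <= c0).
Variable mu : forall i : 'I_N, probability (Rvec R (d i)) R.
Let g := derive1 psi.

(** Both values lie between the dual value of the zero potentials and the cost bound of the product
    coupling. *)
Lemma OT_diff_bounded (nu nu' : forall i, set (Rvec R (d i)) -> \bar R)
  (P P' : probability T R) : (forall i, nu i setT = 1%E) -> (forall i, nu' i setT = 1%E) ->
  is_prod_meas P nu -> is_prod_meas P' nu' ->
  (`|OTphi phi c X nu - OTphi phi c X nu'| <= (c0 + `|psi c0|)%:E)%E.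
Proof.
move=> nu1 nu1' Pnu Pnu'.
have p0 : potentials (@mix R N d) (fun (_ : 'I_N) (_ : T) => 0 : R).
  by move=> i; split => //; exact: bm_cst.
have lo Q : - `|psi c0| <= dual psi cX Q (fun (_ : 'I_N) (_ : T) => 0 : R).
  have := dual_ge conj reg bcX cX0 Q p0 (B := 0).
  by rewrite mulr0 !add0r; apply => i x; rewrite normr0.
have [v -> [v1 v2]] := OT_value conj reg bcX cX0 nu1 Pnu.
have [v' -> [v1' v2']] := OT_value conj reg bcX cX0 nu1' Pnu'.
rewrite -EFinB /= lee_fin; have := lo P; have := lo P'.
have := v2 _ p0; have := v2' _ p0; rewrite ler_norml => h1 h2 h3 h4.
by apply/andP; split; lra.
Qed.

Section LargeSample.
Variables (K L x0 x1 : R).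
Hypotheses (N0 : (0 < N)%N) (K0 : 0 <= K).
Hypothesis Kphi : forall x, 0 <= x -> phi x <= K * (1 + x ^+ 2).
Hypotheses (gx0 : g x0 = 1) (gx1 : 1 < g x1) (L1 : 1 <= L).
Let B := apriori_cst 'I_N c0 x0 x1.
Let Y0 := N%:R * B + c0.
Hypothesis Llip : forall x y, `|x| <= Y0 + (g Y0 + 1) -> `|y| <= Y0 + (g Y0 + 1) ->
  `|g x - g y| <= L * `|x - y|.

Let Cs := stability_cst N psi c0 K B.
Let Mi := N%:R * B + `|psi Y0| + `|psi (- Y0)|.

(** The summands come from population stability, the fluctuation of the dual value, and empirical
    stability. The halves come from [u <= (r + u^2 / r) / 2] with [r = n^(-1/2)]. *)
Definition rate_cst : R :=
  Cs + (1 + (2 * Mi) ^+ 2 * N%:R) / 2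
  + Cs * (1 + N%:R * (1 + (g Y0 + 1) ^+ 2 * N%:R)) / 2.

Let c00 : 0 <= c0. Proof. exact: le_trans (cX0 point). Qed.

Let B0 : 0 <= B.
Proof.
rewrite /B /apriori_cst; have := c00 => c00'; have n0 : (0 : R) <= #|'I_N|%:R by [].
have w0 : 0 <= 2 * c0 + 2 by lra.
by rewrite !addr_ge0// mulr_ge0.
Qed.

Let Cs0 : 0 <= Cs.
Proof.
by rewrite /Cs /stability_cst le_max; apply/orP; right; rewrite !addr_ge0// mulr_ge0.
Qed.

Let g0 y : 0 <= g y. Proof. exact: (dpsi_ge0 conj reg). Qed.

Lemma rate_cst_ge0 : 0 <= rate_cst.
Proof.
have q1 : 0 <= (1 + (2 * Mi) ^+ 2 * N%:R) / 2.
  by rewrite divr_ge0// addr_ge0// mulr_ge0// sqr_ge0.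
have q2 : 0 <= 1 + N%:R * (1 + (g Y0 + 1) ^+ 2 * N%:R).
  by rewrite addr_ge0// mulr_ge0// addr_ge0// mulr_ge0// sqr_ge0.
by rewrite /rate_cst !addr_ge0// divr_ge0// mulr_ge0.
Qed.

Let dual_integrand_bound (h : 'I_N -> T -> R) x : (forall i x, `|h i x| <= B) ->
  `|dual_integrand psi cX h x| <= Mi.
Proof.
move=> hB; apply: (le_trans (ler_normB _ _)); rewrite /Mi -[leRHS]addrA lerD//.
  apply: (le_trans (ler_norm_sum _ _ _)).
  apply: (le_trans (ler_sum _ (fun i _ => hB i x))).
  by rewrite sumr_const card_ord -[leLHS]mulr_natl lexx.
have := pot_bound cX0 x hB; rewrite card_ord -/Y0 => /ler_normlP[h1 h2].
have p1 : psi (pot cX h x) <= psi Y0 by exact: (psi_nd conj reg).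
have p2 : psi (- Y0) <= psi (pot cX h x) by apply: (psi_nd conj reg); lra.
have a1 := ler_norm (psi Y0); have a2 := ler_norm (- psi (- Y0)).
rewrite normrN in a2.
have b1 := normr_ge0 (psi Y0); have b2 := normr_ge0 (psi (- Y0)).
by rewrite ler_norml; apply/andP; split; lra.
Qed.

Lemma OT_sample_rate n dO (Om : measurableType dO) (PO : probability Om R)
  (Y : forall i : 'I_N, 'I_n -> Om -> Rvec R (d i)) : (1 < n)%N ->
  (forall i k, measurable_fun setT (Y i k)) ->
  (forall i k A, measurable A -> PO (Y i k @^-1` A) = mu i A) ->
  mutually_indep PO Y ->
  (\int[PO]_w `| OTphi phi c X (fun i => mu i)
     - OTphi phi c X (fun i => empirical (fun k => Y i k w)) |
   <= (rate_cst * (Num.sqrt n%:R)^-1)%:E)%E.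
Proof.
move=> n1 mY lawY indY; have n0 : (0 < n)%N by exact: ltnW.
pose r : R := (Num.sqrt n%:R)^-1.
have nR : (0 : R) < n%:R by rewrite ltr0n.
have r0 : 0 < r by rewrite invr_gt0 sqrtr_gt0.
have rn0 : r != 0 by rewrite gt_eqF.
have r2 : r ^+ 2 = n%:R^-1 by rewrite exprVn sqr_sqrtr// ltW.
have I0 : (0 < #|'I_N|)%N by rewrite card_ord.
have [P Pmu] := exists_product n0 mY lawY indY.
have mu1 i : mu i setT = 1%E by exact: probability_setT.
have mixP i := mix_measure_preserving i Pmu mu1.
(* Makes the defect bound [4 L eta] equal to [r^2 = 1 / n]. *)
pose eta : R := (4 * L * n%:R)^-1.
have L0 : 0 < L by exact: lt_le_trans ltr01 L1.
have eta0 : 0 < eta by rewrite invr_gt0 !mulr_gt0.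
have Llip' : let B' := apriori_cst 'I_N c0 x0 x1 in
    let Y := #|'I_N|%:R * B' + c0 + (g (#|'I_N|%:R * B' + c0) + 1) in
    forall x y, `|x| <= Y -> `|y| <= Y -> `|g x - g y| <= L * `|x - y|.
  by rewrite card_ord.
have [h [ph hB hd]] := near_optimal (@measurable_mix R N d) (@mixl R N d)
  (@mixr R N d) conj reg bcX cX0 I0 mixP gx0 gx1 L1 Llip' eta0.
have eta2 : 4 * L * eta = r ^+ 2.
  by rewrite r2 /eta invfM mulrA mulfV ?mul1r// gt_eqF// mulr_gt0.
have hr i : \int[P]_x defect (@mix R N d) psi cX P h i x ^+ 2 <= r ^+ 2.
  by rewrite -eta2.
have [v OTv vD] := OT_stability conj reg bcX cX0 mu1 Pmu K0 Kphi N0 ph hB r0 hr.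
have [Q Qprod] := empirical_product Y n0.
pose f x := g (pot cX h x).
have bpot : bm (pot cX h) by exact: bm_pot.
have bf : bm f.
  by apply: bm_comp bpot; [exact: dpsi_continuous reg|exact: dpsi_nd conj reg].
have f1 x : `|f x - 1| <= g Y0 + 1.
  have fA : f x <= g Y0.
    apply: (dpsi_nd conj reg); apply: (le_trans (ler_norm _)).
    by have := pot_bound cX0 x hB; rewrite card_ord.
  by rewrite ler_norml; apply/andP; split; have := g0 (pot cX h x); rewrite -/(f x); lra.
pose Si i w := savg Y (fun x => (savg Y (fun z => f (mix i x z)) w - 1) ^+ 2) w.
pose S w := \sum_i Si i w.
have bSi i : bm (Si i) by exact: (bm_block_defect mY i bf).
have bS : bm S by exact: bm_sum.
pose D := dual psi cX P h.
have bdi : bm (dual_integrand psi cX h) by exact: (bm_dual_integrand conj reg bcX ph).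
pose F x := dual_integrand psi cX h x - D.
have bF : bm F by apply: bmB => //; exact: bm_cst.
have DMi : `|D| <= Mi.
  apply: (le_trans (le_normr_Rintegral _ (bm_integrable P bdi))) => //.
  rewrite -[leRHS](Ecst P); apply: Ele; [exact: bm_abs|exact: bm_cst|].
  by move=> x; exact: dual_integrand_bound.
have FM x : `|F x| <= 2 * Mi.
  apply: (le_trans (ler_normB _ _)).
  by have := dual_integrand_bound x hB; lra.
have F0 : \int[P]_x F x = 0 by rewrite EB//; [rewrite Ecst subrr|exact: bm_cst].
pose V := savg Y F.
have bV : bm V by exact: (bm_savg mY bF).
have EV : \int[PO]_w V w ^+ 2 <= (2 * Mi) ^+ 2 * N%:R * r ^+ 2.
  by rewrite r2 -mulrA; exact: (E_savg_sq n0 mY lawY indY Pmu bF FM F0).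
have ES : \int[PO]_w S w <= N%:R * (1 + (g Y0 + 1) ^+ 2 * N%:R) * r ^+ 2.
  rewrite Esum//; apply: (@le_trans _ _ (\sum_(i < N) (1 + (g Y0 + 1) ^+ 2 * N%:R) * r ^+ 2)).
    apply: ler_sum => i _.
    apply: (le_trans (E_block_defect n0 mY lawY indY Pmu i n1 bf f1)).
    rewrite mulrDl mul1r lerD//; last by rewrite r2 mulrA.
    exact: hr.
  by rewrite sumr_const card_ord -[leLHS]mulr_natl mulrA.
(* A bounded measurable majorant of the error at each [w]. It is affine in [V^2] and [S], so
   second-moment bounds suffice to integrate it. *)
pose W w := Cs * r + (r + V w ^+ 2 / r) / 2 + Cs * ((r + S w / r) / 2).
have bV2 : bm (fun w => (r + V w ^+ 2 / r) / 2).
  apply: bmM; last exact: bm_cst.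
  by apply: bmD; [exact: bm_cst|apply: bmM; [exact: bmX|exact: bm_cst]].
have bS2 : bm (fun w => (r + S w / r) / 2).
  apply: bmM; last exact: bm_cst.
  by apply: bmD; [exact: bm_cst|apply: bmM => //; exact: bm_cst].
have bW : bm W.
  by apply: bmD; [apply: bmD => //; exact: bm_cst|exact: bmZ].
have half k m : bm k -> \int[PO]_w k w <= m * r ^+ 2 ->
    \int[PO]_w ((r + k w / r) / 2) <= (1 + m) / 2 * r.
  move=> bk hk.
  have -> : (fun w => (r + k w / r) / 2) = (fun w => r / 2 + (2 * r)^-1 * k w).
    by apply/funext => w; field.
  rewrite ED; [|exact: bm_cst|exact: bmZ].
  rewrite Ecst EZ//.
  have : (2 * r)^-1 * \int[PO]_w k w <= (2 * r)^-1 * (m * r ^+ 2).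
    by rewrite ler_wpM2l// invr_ge0 mulr_ge0// ltW.
  have -> : (2 * r)^-1 * (m * r ^+ 2) = m / 2 * r by field.
  by set z := (2 * r)^-1 * _ => hz; rewrite mulrDl mulrDl mul1r (mulrC 2^-1); lra.
have EW : \int[PO]_w W w <= rate_cst * r.
  rewrite ED; [|by apply: bmD => //; exact: bm_cst|exact: bmZ].
  rewrite ED; [|exact: bm_cst|by []].
  rewrite Ecst EZ//.
  have h1 := half _ _ (bmX 2 bV) EV; have h2 := half _ _ bS ES.
  have h3 := ler_wpM2l Cs0 h2.
  apply: (le_trans (lerD (lerD (lexx _) h1) h3)).
  by rewrite le_eqVlt; apply/orP; left; apply/eqP; rewrite /rate_cst; ring.
apply: (@le_trans _ _ (\int[PO]_w (W w)%:E)%E); last first.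
  by rewrite EFin_E// lee_fin.
apply: le_integral_any => w.
have [Qw EQ] := Qprod w.
have emp1 i : empirical (fun k => Y i k w) setT = 1%E.
  rewrite /empirical; congr (_%:E).
  rewrite (eq_bigr (fun=> 1)); last by move=> k _; rewrite indicE in_setT.
  by rewrite sumr_const card_ord mulVf// gt_eqF.
(* Dominates the square root of [S w] and stays positive when [S w = 0], as [OT_stability]
   demands. *)
pose t := (r + S w / r) / 2.
have Si0 i : 0 <= Si i w.
  rewrite /Si /savg /avg mulr_ge0// ?invr_ge0//.
  by apply: sumr_ge0 => k _; exact: sqr_ge0.
have S0 : 0 <= S w by apply: sumr_ge0.
have t0 : 0 < t by rewrite divr_gt0// ltr_wpDr// divr_ge0// ltW.
have St : S w <= t ^+ 2.
  rewrite -subr_ge0.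
  have -> : t ^+ 2 - S w = ((r - S w / r) / 2) ^+ 2 by rewrite /t; field.
  exact: sqr_ge0.
have defQ i : \int[Q w]_x defect (@mix R N d) psi cX (Q w) h i x ^+ 2 <= t ^+ 2.
  have -> : \int[Q w]_x defect (@mix R N d) psi cX (Q w) h i x ^+ 2 = Si i w.
    rewrite EQ; last by apply: bmX; apply: (bm_defect _ conj reg bcX) ph; exact: measurable_mix.
    congr (_ * _); apply: eq_bigr => k _; congr ((_ - 1) ^+ 2).
    by rewrite /Eblk EQ//; apply: bm_mixr bf; exact: measurable_mix.
  apply: le_trans St; rewrite /S (bigD1 i)//= lerDl.
  by apply: sumr_ge0.
have [v' OTv' vD'] := OT_stability conj reg bcX cX0 emp1 Qw K0 Kphi N0 ph hB t0 defQ.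
rewrite OTv OTv' -EFinB /= lee_fin.
have VE : V w = dual psi cX (Q w) h - D.
  rewrite /V -EQ// /F EB//; last exact: bm_cst.
  by rewrite Ecst.
have Vle : `|V w| <= (r + V w ^+ 2 / r) / 2.
  rewrite -subr_ge0 -(real_normK (num_real (V w))).
  have -> : (r + `|V w| ^+ 2 / r) / 2 - `|V w| = (r - `|V w|) ^+ 2 / (2 * r) by field.
  by rewrite divr_ge0 ?sqr_ge0// mulr_ge0// ltW.
have -> : v - v' = (v - D) - V w - (v' - dual psi cX (Q w) h) by rewrite VE; ring.
apply: (le_trans (ler_normB _ _)); apply: lerD; last exact: vD'.
apply: (le_trans (ler_normB _ _)); apply: lerD; [exact: vD|exact: Vle].
Qed.

End LargeSample.

End Rate.

Theorem theorem5p3 (R : realType) (N : nat) (d : 'I_N -> nat)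
  (X : forall i : 'I_N, set 'rV[R]_(d i))
  (mu : forall i : 'I_N, probability (Rvec R (d i)) R)
  (phi psi : R -> R) (c : 'rV[R]_(Dtot d) -> R) (s : nat) (dmu : R) :
  (forall i, compact (X i)) ->
  (forall i, mu i (X i) = 1%E) ->
  conv_conjugates phi psi ->
  dual_regular psi ->
  2 * s%:R < dmu ->
  (forall i, cond_I (mu i) dmu s) ->
  Cs_set (Xprod X) s c ->
  Cs1 s psi ->
  exists C : R, forall n : nat, (0 < n)%N ->
    forall (dO : measure_display) (Om : measurableType dO) (PO : probability Om R)
      (Y : forall i : 'I_N, 'I_n -> Om -> Rvec R (d i)),
      (forall i k, measurable_fun setT (Y i k)) ->
      (forall i k A, measurable A -> PO (Y i k @^-1` A) = mu i A) ->
      mutually_indep PO Y ->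
      (\int[PO]_w `| OTphi phi c (Xprod X) (fun i => mu i)
                     - OTphi phi c (Xprod X) (fun i => empirical (fun k => Y i k w)) |
        <= (C * n%:R `^ (- (s%:R / dmu)))%:E)%E.
Proof.
move=> cX _ conj reg sdmu _ Cset psiCs1.
have bcX := bm_cost cX Cset.
have [c0 [c00 cX0]] := bm_le bcX.
have [K [K0 Kphi]] := phi_quadratic conj reg.
have [x0 gx0] := dpsi_eq1 reg; have [x1 gx1] := dpsi_gt1 reg.
pose Cb := c0 + `|psi c0|.
have Cb0 : 0 <= Cb by rewrite addr_ge0.
have mu1 i : mu i setT = 1%E by exact: probability_setT.
have pointwise n dO (Om : measurableType dO) (PO : probability Om R)
    (Y : forall i, 'I_n -> Om -> Rvec R (d i)) w : (0 < n)%N ->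
    (forall i k, measurable_fun setT (Y i k)) ->
    (forall i k A, measurable A -> PO (Y i k @^-1` A) = mu i A) ->
    mutually_indep PO Y ->
    (`| OTphi phi c (Xprod X) (fun i => mu i)
      - OTphi phi c (Xprod X) (fun i => empirical (fun k => Y i k w)) | <= Cb%:E)%E.
  move=> n0 mY lawY indY.
  have [P Pmu] := exists_product n0 mY lawY indY.
  have [Q /(_ w)[Qw _]] := empirical_product Y n0.
  apply: (OT_diff_bounded conj reg bcX cX0 mu1 _ Pmu Qw) => i.
  rewrite /empirical; congr (_%:E).
  rewrite (eq_bigr (fun=> 1)); last by move=> k _; rewrite indicE in_setT.
  by rewrite sumr_const card_ord mulVf// pnatr_eq0 -lt0n.
have trivial_bound n dO (Om : measurableType dO) (PO : probability Om R)
    (Y : forall i, 'I_n -> Om -> Rvec R (d i)) : (0 < n)%N ->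
    (forall i k, measurable_fun setT (Y i k)) ->
    (forall i k A, measurable A -> PO (Y i k @^-1` A) = mu i A) ->
    mutually_indep PO Y ->
    (\int[PO]_w `| OTphi phi c (Xprod X) (fun i => mu i)
      - OTphi phi c (Xprod X) (fun i => empirical (fun k => Y i k w)) | <= Cb%:E)%E.
  move=> n0 mY lawY indY.
  apply: (@le_trans _ _ (\int[PO]_w (Cb%:E))%E).
    by apply: le_integral_any => w; exact: (pointwise n dO Om PO).
  by rewrite integral_cst// [X in (_ * X)%E]probability_setT mule1.
(* With [s = 0] the rate is constant, and the uniform bound on the difference suffices. *)
have [s0|s0] := posnP s.
  exists Cb => n n0 dO Om PO Y mY lawY indY.
  rewrite s0 mul0r oppr0 powRr0 mulr1.
  exact: trivial_bound.
have dmu0 : 0 < dmu by apply: le_lt_trans sdmu; rewrite mulr_ge0.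
(* With no blocks the two families of measures coincide; finiteness of the value makes the
   extended-real difference 0. *)
have [N0|N0] := posnP N.
  exists 0 => n n0 dO Om PO Y mY lawY indY; rewrite mul0r.
  have empE w : (fun i => empirical (fun k => Y i k w)) =
      (fun i => mu i : set (Rvec R (d i)) -> \bar R).
    by apply/functional_extensionality_dep => i; have := ltn_ord i; rewrite {2}N0.
  apply: (@le_trans _ _ (\int[PO]_w (0%R%:E))%E); last by rewrite integral0.
  apply: le_integral_any => w; rewrite empE.
  have [P Pmu] := exists_product n0 mY lawY indY.
  have [v -> _] := OT_value conj reg bcX cX0 mu1 Pmu.
  by rewrite -EFinB subrr /= normr0.
pose B := apriori_cst 'I_N c0 x0 x1.
pose Y0 := N%:R * B + c0 + (derive1 psi (N%:R * B + c0) + 1).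
have [L [L1 Llip]] := dpsi_locally_lipschitz reg Y0 s0 psiCs1.
pose Cr := rate_cst N psi c0 K x0 x1.
have Cr0 : 0 <= Cr by exact: (rate_cst_ge0 psi cX0).
exists (Num.max Cb Cr) => n n0 dO Om PO Y mY lawY indY.
have rate0 : 0 <= n%:R `^ (- (s%:R / dmu)) by exact: powR_ge0.
(* One sample is too few for [E_block_defect], but then the rate equals 1. *)
have [n1|n1] := leqP n 1.
  have -> : n%:R `^ (- (s%:R / dmu)) = 1 :> R.
    have -> : n = 1%N by apply/eqP; rewrite eqn_leq n1 n0.
    by rewrite powR1.
  rewrite mulr1; apply: (le_trans (trivial_bound _ _ _ _ _ n0 mY lawY indY)).
  by rewrite lee_fin le_max lexx.
apply: (le_trans (OT_sample_rate conj reg bcX cX0 N0 K0 Kphi gx0 gx1 L1 Llip n1 mY lawY indY)).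
rewrite lee_fin; apply: ler_pM => //.
  by rewrite le_max lexx orbT.
(* As [2 s < dmu], the exponent [- 1/2] is at most [- s / dmu], and [1 <= n]. *)
rewrite -powR12_sqrt// -powRN; apply: ler_powR.
  by rewrite ler1n.
by rewrite lerN2 ler_pdivrMr// mulrC ler_pdivlMr// mulrC ltW.
Qed.
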